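(* Let $g$ be a symmetric, non-singular type $(0,2)$ tensor field on $Q$, let $L=\frac12 g_{ij}u^iu^j$ on $TQ$, let $J$ be a type $(1,1)$ tensor field on $Q$, let $f\in C^\infty(Q)$, and let $R$ be the type $(1,1)$ tensor field on $TQ$ defined by $i_{R(\xi)}\,dd_SL=i_\xi\,dd_{J^cS}L$ for all vector fields $\xi$ on $TQ$. Then $$\mathcal{L}_\Gamma R=\Gamma\otimes df-\xi_f\otimes dE_L$$ if and only if $J=\overline{J}$ and $$\nabla J=\tfrac12\left(\mathbf{T}\otimes d^Hf-X_f\otimes\theta_L\right).$$ In addition, in that case $U$ is of the form $$U=-\tfrac12\left(\mathbf{T}\otimes d^Hf+X_f\otimes\theta_L\right),$$ $J$ further has the property $$\Phi J-J\Phi=\tfrac12\left(\mathbf{T}\otimes\nabla d^Hf+\nabla X_f\otimes\theta_L\right),$$ and the tensor field $R$ itself is given by $$R=J^c-\Delta\otimes df .$$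
   Context: $Q$ is a smooth $n$-dimensional manifold, $\tau:TQ\to Q$ its tangent bundle with natural coordinates $(q^i,u^i)$. $S=\frac{\partial}{\partial u^i}\otimes dq^i$ is the vertical endomorphism. A type $(1,1)$ tensor field $K$ acts on 1-forms by $(K\alpha)(\xi)=\alpha(K\xi)$, and $d_KL:=K(dL)=dL\circ K$. Put $\theta_L=d_SL$, $\omega_L=d\theta_L$ (symplectic), $\Delta=u^i\partial/\partial u^i$, $E_L=\Delta(L)-L$ ($=L$ here). The Euler-Lagrange field $\Gamma=u^i\frac{\partial}{\partial q^i}+f^i\frac{\partial}{\partial u^i}$ is defined by $i_\Gamma d\theta_L=-dE_L$ (here it is the geodesic spray of $g$). $\xi_f$ is the Hamiltonian vector field of (the pullback to $TQ$ of) $f$: $i_{\xi_f}d\theta_L=-df$. The complete lift $J^c$ is the type $(1,1)$ tensor field on $TQ$ with $J^c(X^c)=(JX)^c$, $J^c(X^V)=(JX)^V$ for vector fields $X$ on $Q$, where $X^c$, $X^V$ are complete and vertical lifts. $\overline J$ is the transpose of $J$ with respect to $g$: $g(JX,Y)=g(X,\overline JY)$. Connection: $\Gamma^i_j=-\frac12\partial f^i/\partial u^j$, $H_i=\frac{\partial}{\partial q^i}-\Gamma^k_i\frac{\partial}{\partial u^k}$, $V_i=\frac{\partial}{\partial u^i}$. For a vector field $X=X^i(q,u)\partial/\partial q^i$ along $\tau$ put $X^H=X^iH_i$, $X^V=X^iV_i$. $D^H_XF=X^H(F)$, $D^V_XF=X^V(F)$, $\nabla F=\Gamma(F)$ on functions;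 on vector fields along $\tau$, $[X^H,Y^V]=(D^H_XY)^V-(D^V_YX)^H$ and $[\Gamma,X^V]=-X^H+(\nabla X)^V$; all extend to tensor fields along $\tau$ as derivations commuting with contractions. $\Phi$ (Jacobi endomorphism) is the type $(1,1)$ tensor field along $\tau$ with $[\Gamma,X^H]=(\nabla X)^H+(\Phi X)^V$. Here $(\nabla J)^i_j=J^i_{j|k}u^k$ with $|$ the Levi-Civita covariant derivative of $g$. $\mathbf{T}=u^i\partial/\partial q^i$ is the canonical vector field along $\tau$. $\theta_L$ is also regarded as a 1-form along $\tau$: $\theta_L(X)=D^V_XL=g(\mathbf{T},X)$. $d^HF(X)=D^H_XF$ on functions and $d^H\alpha(X,Y)=(D^H_X\alpha)(Y)-(D^H_Y\alpha)(X)$ on 1-forms along $\tau$. $X_f$ is the vector field along $\tau$ with $g(X_f,Y)=-d^Hf(Y)$ for all $Y$. $U$ is the type $(1,1)$ tensor field along $\tau$ determined by $g(UX,Y)=d^H(J\theta_L)(X,Y)$, with $(J\theta_L)(X)=\theta_L(JX)$. For a vector field $Z$ and 1-form $\alpha$, $Z\otimes\alpha$ is the type $(1,1)$ tensor $X\mapsto\alpha(X)Z$. *)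

(* Defs.v *)
From HB Require Import structures.
From mathcomp Require Import all_boot all_order all_algebra.
From mathcomp Require Import all_classical all_reals all_analysis.
Set Implicit Arguments.
Unset Strict Implicit.
Unset Printing Implicit Defensive.
Import Order.TTheory GRing.Theory Num.Theory.
Import numFieldNormedType.Exports.
Local Open Scope classical_set_scope.
Local Open Scope ring_scope.

(* Points of R^m and components of vectors are columns, components of 1-forms
   are rows.  A type (1,1) tensor K is the matrix K i j = K^i_j, so that
   K(X) = K *m X, alpha o K = alpha *m K and Z (x) alpha = Z *m alpha; a type
   (0,2) tensor w is the matrix w i j = w(e_i, e_j). *)

Section Calculus.
Context {R : realType}.

Definition pd m (F : 'cV[R]_m -> R) (i : 'I_m) (x : 'cV[R]_m) : R :=
  'D_(delta_mx i 0) F x.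

Fixpoint Ck_on (k m : nat) (O : set 'cV[R]_m) (F : 'cV[R]_m -> R) : Prop :=
  (forall x, O x -> {for x, continuous F}) /\
  if k is k'.+1 then
    forall i : 'I_m, (forall x, O x -> derivable F x (delta_mx i 0)) /\
                     Ck_on k' O (pd F i)
  else True.

Definition smooth_on m (O : set 'cV[R]_m) (F : 'cV[R]_m -> R) : Prop :=
  forall k, Ck_on k O F.

Definition smooth_mx_on m p q (O : set 'cV[R]_m) (F : 'cV[R]_m -> 'M[R]_(p, q)) :
    Prop :=
  forall i j, smooth_on O (fun x => F x i j).

Definition jac m p (F : 'cV[R]_m -> 'cV[R]_p) (x : 'cV[R]_m) : 'M[R]_(p, m) :=
  \matrix_(i, j) pd (fun y => F y i 0) j x.

Section Exterior.
Variable m : nat.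
Implicit Types (X Y : 'cV[R]_m -> 'cV[R]_m) (K : 'cV[R]_m -> 'M[R]_m).

(* X(F) = X^i d_i F *)
Definition vact X (F : 'cV[R]_m -> R) (x : 'cV[R]_m) : R :=
  \sum_i X x i 0 * pd F i x.

Definition bracket X Y (x : 'cV[R]_m) : 'cV[R]_m :=
  \col_i (vact X (fun y => Y y i 0) x - vact Y (fun y => X y i 0) x).

Definition app K X (x : 'cV[R]_m) : 'cV[R]_m := K x *m X x.

(* (L_X K)(Y) = [X, K Y] - K [X, Y] *)
Definition lie11 X K Y (x : 'cV[R]_m) : 'cV[R]_m :=
  bracket X (app K Y) x - K x *m bracket X Y x.

Definition d0 (F : 'cV[R]_m -> R) (x : 'cV[R]_m) : 'rV[R]_m := \row_i pd F i x.

Definition d1 (alpha : 'cV[R]_m -> 'rV[R]_m) (x : 'cV[R]_m) : 'M[R]_m :=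
  \matrix_(i, j) (pd (fun y => alpha y 0 j) i x - pd (fun y => alpha y 0 i) j x).

Definition dK K (F : 'cV[R]_m -> R) (x : 'cV[R]_m) : 'rV[R]_m := d0 F x *m K x.

Definition iprod (v : 'cV[R]_m) (w : 'M[R]_m) : 'rV[R]_m := v^T *m w.

End Exterior.
End Calculus.

Section Manifolds.
Variable R : realType.

(* Smooth n-manifolds: [param a] is the inverse of the chart [coord a], which
   is a homeomorphism from [dom a] onto the open set [img a] of R^n. *)
Record manifold (n : nat) := Manifold {
  space :> topologicalType;
  space_hausdorff : hausdorff_space space;
  space_second_countable : @second_countable space;
  chart_idx : Type;
  dom : chart_idx -> set space;
  img : chart_idx -> set 'cV[R]_n;
  coord : chart_idx -> space -> 'cV[R]_n;
  param : chart_idx -> 'cV[R]_n -> space;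
  dom_open : forall a, open (dom a);
  img_open : forall a, open (img a);
  dom_cover : forall p, exists a, dom a p;
  coord_img : forall a p, dom a p -> img a (coord a p);
  param_dom : forall a x, img a x -> dom a (param a x);
  coordK : forall a p, dom a p -> param a (coord a p) = p;
  paramK : forall a x, img a x -> coord a (param a x) = x;
  coord_cont : forall a p, dom a p -> {for p, continuous (coord a)};
  param_cont : forall a x, img a x -> {for x, continuous (param a)};
  transition_smooth : forall a b,
    smooth_mx_on (img a `&` param a @^-1` dom b) (coord b \o param a)
}.

(* A rank r vector bundle over an m-manifold, in adapted coordinates: a is a
   coordinate system with image [chart a], [trans a b] the change of base
   coordinates on [overlap a b], [cocycle a b] that of fibre components. *)
Record bundle (m r : nat) := Bundle {
  idx : Type;
  chart : idx -> set 'cV[R]_m;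
  overlap : idx -> idx -> set 'cV[R]_m;
  trans : idx -> idx -> 'cV[R]_m -> 'cV[R]_m;
  cocycle : idx -> idx -> 'cV[R]_m -> 'M[R]_r
}.

(* Tensor fields: smooth components in every coordinate system, obeying the
   tensor transformation law. *)
Record vector_field m r (B : bundle m r) := VectorField {
  vf_comp :> idx B -> 'cV[R]_m -> 'cV[R]_r;
  vf_smooth : forall a, smooth_mx_on (chart a) (vf_comp a);
  vf_trans : forall a b x, overlap a b x ->
    vf_comp b (trans a b x) = cocycle a b x *m vf_comp a x
}.

Record tensor11 m r (B : bundle m r) := Tensor11 {
  t11_comp :> idx B -> 'cV[R]_m -> 'M[R]_r;
  t11_smooth : forall a, smooth_mx_on (chart a) (t11_comp a);
  t11_trans : forall a b x, overlap a b x ->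
    t11_comp b (trans a b x) *m cocycle a b x = cocycle a b x *m t11_comp a x
}.

Record tensor02 m r (B : bundle m r) := Tensor02 {
  t02_comp :> idx B -> 'cV[R]_m -> 'M[R]_r;
  t02_smooth : forall a, smooth_mx_on (chart a) (t02_comp a);
  t02_trans : forall a b x, overlap a b x ->
    t02_comp a x = (cocycle a b x)^T *m t02_comp b (trans a b x) *m cocycle a b x
}.

Variable n : nat.

(* A point of TQ has natural coordinates (q, u) = col_mx q u. *)
Definition qc (z : 'cV[R]_(n + n)) : 'cV[R]_n := usubmx z.
Definition uc (z : 'cV[R]_(n + n)) : 'cV[R]_n := dsubmx z.

Definition tangent_map (F : 'cV[R]_n -> 'cV[R]_n) (z : 'cV[R]_(n + n)) :
    'cV[R]_(n + n) :=
  col_mx (F (qc z)) (jac F (qc z) *m uc z).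

Variable Q : manifold n.

Definition Qoverlap (a b : chart_idx Q) : set 'cV[R]_n :=
  img a `&` param a @^-1` dom b.

Definition Qtrans (a b : chart_idx Q) : 'cV[R]_n -> 'cV[R]_n :=
  coord b \o param a.

(* Its sections are the vector fields on Q. *)
Definition onQ : bundle n n :=
  {| chart := @img n Q; overlap := Qoverlap; trans := Qtrans;
     cocycle := fun a b => jac (Qtrans a b) |}.

(* Its sections are the vector fields on TQ. *)
Definition onTQ : bundle (n + n) (n + n) :=
  {| chart := fun a : chart_idx Q => qc @^-1` img a;
     overlap := fun a b => qc @^-1` Qoverlap a b;
     trans := fun a b => tangent_map (Qtrans a b);
     cocycle := fun a b => jac (tangent_map (Qtrans a b)) |}.

(* Its sections are the vector fields along tau : TQ -> Q. *)
Definition alongtau : bundle (n + n) n :=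
  {| chart := fun a : chart_idx Q => qc @^-1` img a;
     overlap := fun a b => qc @^-1` Qoverlap a b;
     trans := fun a b => tangent_map (Qtrans a b);
     cocycle := fun a b => jac (Qtrans a b) \o qc |}.

Record smooth_fun := SmoothFun {
  sf_fun :> Q -> R;
  sf_smooth : forall a : chart_idx Q, smooth_on (img a) (sf_fun \o param a)
}.

(* The pullback of f to TQ, in natural coordinates. *)
Definition pullback (f : smooth_fun) (a : chart_idx Q) (z : 'cV[R]_(n + n)) : R :=
  f (param a (qc z)).

End Manifolds.

Arguments qc {R n} z.
Arguments uc {R n} z.
Arguments onQ {R n} Q.
Arguments onTQ {R n} Q.
Arguments alongtau {R n} Q.

Section TangentGeometry.
Context {R : realType} {n : nat}.
Local Notation E := 'cV[R]_(n + n).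
Implicit Types (X Y : E -> 'cV[R]_n) (K : E -> 'M[R]_n) (G : E -> E).

Definition vertS : 'M[R]_(n + n) := block_mx 0 0 1%:M 0.

Definition Liouville (z : E) : E := col_mx 0 (uc z).

Definition canT (z : E) : 'cV[R]_n := uc z.

Definition vlift X (z : E) : E := col_mx 0 (X z).

(* X^c = X^i d/dq^i + u^k (d X^i/d q^k) d/du^i *)
Definition clift (X : 'cV[R]_n -> 'cV[R]_n) : E -> E := tangent_map X.

(* The connection of G = u^i d/dq^i + f^i d/du^i, where f = uc \o G. *)
Definition conn G (z : E) : 'M[R]_n :=
  \matrix_(i, j) (- 2^-1 * pd (fun w => uc (G w) i 0) (rshift n j) z).

Definition hlift G X (z : E) : E := col_mx (X z) (- (conn G z *m X z)).

(* The Y such that W = X^H + Y^V for some X. *)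
Definition vpart G (W : E -> E) (z : E) : 'cV[R]_n :=
  uc (W z) + conn G z *m qc (W z).

(* [X^H, Y^V] = (DH_X Y)^V - (DV_Y X)^H *)
Definition DH G X Y : E -> 'cV[R]_n :=
  vpart G (bracket (hlift G X) (vlift Y)).

(* [G, X^V] = - X^H + (nabla X)^V *)
Definition nabla G X : E -> 'cV[R]_n := vpart G (bracket G (vlift X)).

(* 1-forms along tau, through their action on vector fields along tau. *)
Definition form1 := (E -> 'cV[R]_n) -> E -> R.

Definition DVfun (F : E -> R) : form1 := fun X => vact (vlift X) F.

Definition dHfun G (F : E -> R) : form1 := fun X => vact (hlift G X) F.

Definition form_comp (alpha : form1) K : form1 :=
  fun X => alpha (fun z => K z *m X z).

Definition DHform G X (alpha : form1) : form1 :=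
  fun Y z => vact (hlift G X) (alpha Y) z - alpha (DH G X Y) z.

Definition dHform G (alpha : form1) X Y (z : E) : R :=
  DHform G X alpha Y z - DHform G Y alpha X z.

Definition nabla_form G (alpha : form1) : form1 :=
  fun X z => vact G (alpha X) z - alpha (nabla G X) z.

Definition nabla11 G K X (z : E) : 'cV[R]_n :=
  nabla G (fun w => K w *m X w) z - K z *m nabla G X z.

(* Z (x) alpha *)
Definition tens (Z : E -> 'cV[R]_n) (alpha : form1) X (z : E) : 'cV[R]_n :=
  alpha X z *: Z z.

End TangentGeometry.

Section Lagrangian.
Variables (R : realType) (n : nat) (Q : manifold R n) (g : tensor02 (onQ Q)).
Local Notation E := 'cV[R]_(n + n).

Definition nonsingular := forall (a : idx (onQ Q)) x, chart a x -> g a x \in unitmx.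
Definition symmetric02 := forall (a : idx (onQ Q)) x, chart a x -> (g a x)^T = g a x.

(* g(v, w) for v, w in the tangent space at tau(z) *)
Definition gprod (a : idx (onQ Q)) (z : E) (v w : 'cV[R]_n) : R :=
  (v^T *m g a (qc z) *m w) 0 0.

Definition lagr (a : idx (onQ Q)) (z : E) : R :=
  2^-1 * gprod a z (uc z) (uc z).

Definition theta (a : idx (onQ Q)) : E -> 'rV[R]_(n + n) :=
  dK (fun=> vertS) (lagr a).

Definition omega (a : idx (onQ Q)) : E -> 'M[R]_(n + n) := d1 (theta a).

Definition energy (a : idx (onQ Q)) (z : E) : R :=
  vact Liouville (lagr a) z - lagr a z.

Definition theta_tau (a : idx (onQ Q)) : form1 := DVfun (lagr a).

Definition euler_lagrange (Gam : vector_field (onTQ Q)) : Prop :=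
  forall a z, chart a z -> iprod (Gam a z) (omega a z) = - d0 (energy a) z.

Definition hamiltonian (f : smooth_fun Q) (xi : vector_field (onTQ Q)) : Prop :=
  forall a z, chart a z -> iprod (xi a z) (omega a z) = - d0 (pullback f a) z.

Definition g_transpose (J Jbar : tensor11 (onQ Q)) : Prop :=
  forall (a : idx (onQ Q)) x, chart a x -> forall v w : 'cV[R]_n,
    ((J a x *m v)^T *m g a x *m w) 0 0 = (v^T *m g a x *m (Jbar a x *m w)) 0 0.

(* Universally quantified vector fields range over the smooth fields on
   coordinate domains. *)
Definition is_complete_lift (J : tensor11 (onQ Q)) (Jc : tensor11 (onTQ Q)) : Prop :=
  forall (a : idx (onQ Q)) (X : 'cV[R]_n -> 'cV[R]_n),
    smooth_mx_on (chart a) X ->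
    forall z : E, chart (b := onTQ Q) a z ->
      Jc a z *m clift X z = clift (app (J a) X) z /\
      Jc a z *m vlift (X \o qc) z = vlift (app (J a) X \o qc) z.

(* i_{R xi} dd_S L = i_xi dd_{J^c S} L *)
Definition is_R (Jc Rt : tensor11 (onTQ Q)) : Prop :=
  forall (a : idx (onTQ Q)) (xi : E -> E), smooth_mx_on (chart a) xi ->
    forall z, chart a z ->
      iprod (Rt a z *m xi z) (omega a z) =
      iprod (xi z) (d1 (dK (fun w => Jc a w *m vertS) (lagr a)) z).

Definition is_Xf (Gam : vector_field (onTQ Q)) (f : smooth_fun Q)
    (Xf : vector_field (alongtau Q)) : Prop :=
  forall (a : idx (alongtau Q)) (Y : E -> 'cV[R]_n), smooth_mx_on (chart a) Y ->
    forall z, chart a z ->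
      gprod a z (Xf a z) (Y z) = - dHfun (Gam a) (pullback f a) Y z.

Definition is_U (Gam : vector_field (onTQ Q)) (J : tensor11 (onQ Q))
    (U : tensor11 (alongtau Q)) : Prop :=
  forall (a : idx (alongtau Q)) (X Y : E -> 'cV[R]_n),
    smooth_mx_on (chart a) X -> smooth_mx_on (chart a) Y ->
    forall z, chart a z ->
      gprod a z (U a z *m X z) (Y z) =
      dHform (Gam a) (form_comp (theta_tau a) (J a \o qc)) X Y z.

Definition is_jacobi (Gam : vector_field (onTQ Q)) (Phi : tensor11 (alongtau Q)) :
    Prop :=
  forall (a : idx (alongtau Q)) (X : E -> 'cV[R]_n), smooth_mx_on (chart a) X ->
    forall z, chart a z ->
      bracket (Gam a) (hlift (Gam a) X) z =
      hlift (Gam a) (nabla (Gam a) X) z + vlift (fun w => Phi a w *m X w) z.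

End Lagrangian.

(* Main.v *)
Require Import Defs.
From HB Require Import structures.
From mathcomp Require Import all_boot all_order all_algebra.
From mathcomp Require Import all_classical all_reals all_analysis.
From mathcomp Require Import ring lra.
Import Order.TTheory GRing.Theory Num.Theory.
Import numFieldNormedType.Exports.
Local Open Scope classical_set_scope.
Local Open Scope ring_scope.
Set Implicit Arguments.
Unset Strict Implicit.
Unset Printing Implicit Defensive.

(** The statement compares tensor fields, so it may be checked in one
coordinate system at a time: it becomes an equivalence between identities for
matrices of functions of (q, u), where q runs over an open set of R^n.

Let C be the connection matrix of the spray Gamma.  Differentiating the
Euler-Lagrange equation along the fibres gives Koszul's formula ([koszul]);
hence C is linear in u, torsion free and compatible with g.  With respect to
horizontal and vertical lifts the symplectic form is then
omega(v, w) = g(v^V, w^H) - g(w^V, v^H) ([omega_conn]), where v^H and v^V are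
the components of v, and R is given by
R(X^H) = (JX)^H + (UX)^V and R(X^V) = (Jbar X)^V ([R_block]).

Suppose the equation for L_Gamma R holds.  It splits into four blocks
([lieR_block], [hamiltonian_block]), which amount to J = Jbar,
nabla J - U = T (x) d^H f, nabla J + U = - X_f (x) theta_L and
Phi J - J Phi + nabla U = 0.  Adding and subtracting gives nabla J and U, the
second equation is also the formula for R, and substituting U in the last one
gives the commutator of J with Phi, as T and theta_L are parallel along Gamma.

Conversely, suppose J = Jbar and the formula for nabla J.  A direct check of the
fourth block would need the Ricci and Bianchi identities; exactness of the
forms involved replaces them.  Put
omega_J = d d_{J^c S} L, so that omega(R xi, eta) = omega_J(xi, eta).  Both
forms are exact and L_Gamma omega = 0, so by Cartan's formula ([lie_d1])
omega((L_Gamma R) xi, eta) = d(i_Gamma omega_J)(xi, eta) ([lieR_omega]).  The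
formula for nabla J holds for all u over a given point q and is linear in u,
so that it determines the whole covariant derivative of J.  This yields
i_Gamma omega_J = L df - d(g(Ju, u)/2) ([contraction_omegaJ]).  The
differential of the right hand side is dL /\ df because second derivatives
commute ([schwarz]), and dL /\ df is also what omega makes of
Gamma (x) df - xi_f (x) dE_L.  As omega is nondegenerate, the equation for
L_Gamma R follows ([lieR_hamiltonian]). *)

(** * Matrices as bilinear forms *)

(** With [mxE] the entries of matrix products would become sums; these four rules
leave them as atoms for [ring] and [lra]. *)
Lemma entryD (V : nmodType) p q (A B : 'M[V]_(p, q)) i j : (A + B) i j = A i j + B i j.
Proof. by rewrite mxE. Qed.
Lemma entryN (V : zmodType) p q (A : 'M[V]_(p, q)) i j : (- A) i j = - A i j.
Proof. by rewrite mxE. Qed.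
Lemma entryZ (S : pzRingType) p q (a : S) (A : 'M[S]_(p, q)) i j : (a *: A) i j = a * A i j.
Proof. by rewrite mxE. Qed.
Lemma entry0 (V : nmodType) p q i j : (0 : 'M[V]_(p, q)) i j = 0.
Proof. by rewrite mxE. Qed.

Ltac mx_ring :=
  apply/matrixP => ? ?; rewrite !(entryD, entryN, entryZ, entry0); ring.

Lemma mulmx_inj (S : pzRingType) p q (A B : 'M[S]_(p, q)) :
  (forall v : 'cV_q, A *m v = B *m v) -> A = B.
Proof.
move=> AB; apply/matrixP => i j; have := AB (delta_mx j 0).
by rewrite -!colE => /matrixP/(_ i 0); rewrite !mxE.
Qed.

(** Z (x) alpha sends c to alpha(c) Z. *)
Lemma mul_col_row1 (R : realType) p q (u : 'cV[R]_p) (r : 'rV[R]_q) (c : 'cV[R]_q) :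
  u *m r *m c = (r *m c) 0 0 *: u.
Proof. by rewrite -mulmxA -mul_mx_scalar -mx11_scalar. Qed.

Section BilinearForms.
Context {R : realType}.

Definition bil p q (M : 'M[R]_(p, q)) (v : 'cV[R]_p) (w : 'cV[R]_q) : R :=
  (v^T *m M *m w) 0 0.

Lemma bil_delta p q (M : 'M[R]_(p, q)) i j : bil M (delta_mx i 0) (delta_mx j 0) = M i j.
Proof. by rewrite /bil trmx_delta -rowE -colE !mxE. Qed.

Lemma bilP p q (M N : 'M[R]_(p, q)) : (forall v w, bil M v w = bil N v w) -> M = N.
Proof. by move=> MN; apply/matrixP => i j; rewrite -!bil_delta MN. Qed.

Lemma bil1_inj p (v w : 'cV[R]_p) : (forall y : 'cV[R]_p, bil 1%:M y v = bil 1%:M y w) -> v = w.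
Proof.
move=> vw; apply/matrixP => i j; rewrite ord1.
by have := vw (delta_mx i 0); rewrite /bil !mulmx1 trmx_delta -!rowE !mxE.
Qed.

Lemma bilMr p q r (M : 'M[R]_(p, q)) (N : 'M[R]_(q, r)) v w : bil (M *m N) v w = bil M v (N *m w).
Proof. by rewrite /bil !mulmxA. Qed.

Lemma bilMl p q r (M : 'M[R]_(q, p)) (N : 'M[R]_(q, r)) v w :
  bil (M^T *m N) v w = bil N (M *m v) w.
Proof. by rewrite /bil trmx_mul !mulmxA. Qed.

Lemma bil_tr p q (M : 'M[R]_(p, q)) v w : bil M^T v w = bil M w v.
Proof.
have E : (w^T *m M *m v)^T = v^T *m M^T *m w by rewrite !trmx_mul trmxK mulmxA.
by rewrite /bil -E mxE.
Qed.

Lemma bilDm p q (M N : 'M[R]_(p, q)) v w : bil (M + N) v w = bil M v w + bil N v w.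
Proof. by rewrite /bil mulmxDr mulmxDl mxE. Qed.
Lemma bilNm p q (M : 'M[R]_(p, q)) v w : bil (- M) v w = - bil M v w.
Proof. by rewrite /bil mulmxN mulNmx mxE. Qed.
Lemma bilZm p q a (M : 'M[R]_(p, q)) v w : bil (a *: M) v w = a * bil M v w.
Proof. by rewrite /bil -scalemxAr -scalemxAl mxE. Qed.
Lemma bilDl p q (M : 'M[R]_(p, q)) v v' w : bil M (v + v') w = bil M v w + bil M v' w.
Proof. by rewrite /bil linearD/= !mulmxDl mxE. Qed.
Lemma bilNl p q (M : 'M[R]_(p, q)) v w : bil M (- v) w = - bil M v w.
Proof. by rewrite /bil linearN/= !mulNmx mxE. Qed.
Lemma bilZl p q a (M : 'M[R]_(p, q)) v w : bil M (a *: v) w = a * bil M v w.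
Proof. by rewrite /bil linearZ/= -!scalemxAl mxE. Qed.
Lemma bilDr p q (M : 'M[R]_(p, q)) v w w' : bil M v (w + w') = bil M v w + bil M v w'.
Proof. by rewrite /bil mulmxDr mxE. Qed.
Lemma bilNr p q (M : 'M[R]_(p, q)) v w : bil M v (- w) = - bil M v w.
Proof. by rewrite /bil mulmxN mxE. Qed.
Lemma bilZr p q a (M : 'M[R]_(p, q)) v w : bil M v (a *: w) = a * bil M v w.
Proof. by rewrite /bil -scalemxAr mxE. Qed.

Lemma bil0m p q v w : bil (0 : 'M[R]_(p, q)) v w = 0.
Proof. by rewrite /bil mulmx0 mul0mx mxE. Qed.
Lemma bil0l p q (M : 'M[R]_(p, q)) w : bil M 0 w = 0.
Proof. by rewrite /bil linear0 !mul0mx mxE. Qed.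
Lemma bil0r p q (M : 'M[R]_(p, q)) v : bil M v 0 = 0.
Proof. by rewrite /bil mulmx0 mxE. Qed.

Definition bilE := (bilDm, bilNm, bilZm, bilDl, bilNl, bilZl, bilDr, bilNr, bilZr).

End BilinearForms.

(** * Functions of class C^k *)

Section PartialDerivatives.
Context {R : realType} {m : nat}.
Implicit Types (F G : 'cV[R]_m -> R) (O : set 'cV[R]_m) (x v : 'cV[R]_m).

Lemma line_cvg x v (t : R) : (fun h : R => h *: v + x) @ t --> t *: v + x.
Proof. by apply: cvgD; [apply: cvgZr_tmp; exact: cvg_id|exact: cvg_cst]. Qed.

Lemma near_line O x v : open O -> O x -> \forall h \near (0 : R), O (h *: v + x).
Proof.
move=> oO Ox; apply: (@line_cvg x v 0 O).
by rewrite scale0r add0r; exact: open_nbhs_nbhs.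
Qed.

(** Partial derivatives only test a function along lines, so an identity on an
open set carries over to partial derivatives there. *)
Lemma difference_quotient_near O F G x v : open O -> O x ->
    (forall y, O y -> F y = G y) ->
  (fun h : R => h^-1 *: ((F \o shift x) (h *: v) - F x)) @ 0^' =
  (fun h : R => h^-1 *: ((G \o shift x) (h *: v) - G x)) @ 0^'.
Proof.
move=> oO Ox FG; have H : \forall h \near 0^',
    h^-1 *: ((F \o shift x) (h *: v) - F x) =
    h^-1 *: ((G \o shift x) (h *: v) - G x).
  have := near_line v oO Ox => /nbhs_dnbhs; apply: filterS => h Oh /=.
  by rewrite (FG _ Ox) (FG _ Oh).
apply/seteqP; split=> A /=; rewrite !nbhs_simpl/=; apply: filterS2 H => h.
- by rewrite /preimage/= => <-.
- by rewrite /preimage/= => ->.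
Qed.

Lemma derivable_eq_on O F G x v : open O -> O x ->
  (forall y, O y -> F y = G y) -> derivable F x v -> derivable G x v.
Proof. by move=> oO Ox FG; rewrite /derivable (difference_quotient_near v oO Ox FG). Qed.

Lemma pd_eq_on O F G i x : open O -> O x ->
  (forall y, O y -> F y = G y) -> pd F i x = pd G i x.
Proof.
by move=> oO Ox FG; rewrite /pd /derive (difference_quotient_near _ oO Ox FG).
Qed.

Lemma pd_cst (c : R) i x : pd (fun=> c) i x = 0.
Proof. exact: derive_cst. Qed.

Lemma pdD F G i x : derivable F x (delta_mx i 0) -> derivable G x (delta_mx i 0) ->
  pd (fun y => F y + G y) i x = pd F i x + pd G i x.
Proof. exact: deriveD. Qed.

Lemma pdM F G i x : derivable F x (delta_mx i 0) -> derivable G x (delta_mx i 0) ->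
  pd (fun y => F y * G y) i x = pd F i x * G x + F x * pd G i x.
Proof.
move=> dF dG; rewrite [RHS]addrC [X in _ = _ + X]mulrC.
exact: (deriveM dF dG).
Qed.

Lemma pd_coord (i j : 'I_m) x : pd (fun y => y i 0) j x = (i == j)%:R.
Proof.
apply/cvg_lim; first exact: norm_hausdorff.
apply: (@cvg_trans _ (cst (i == j)%:R @ (0 : R)^')); last exact: cvg_cst.
apply: near_eq_cvg; near=> h => /=.
rewrite !mxE/= addrK eqxx andbT /GRing.scale/= mulKf//.
by near: h; exact: nbhs_dnbhs_neq.
Unshelve. all: by end_near. Qed.

Lemma derivable_coord (i : 'I_m) x v : derivable (fun y : 'cV[R]_m => y i 0) x v.
Proof. exact: diff_derivable (differentiable_coord _ _ _). Qed.

End PartialDerivatives.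

Section Smoothness.
Context {R : realType} {m : nat}.
Implicit Types (F G : 'cV[R]_m -> R) (O : set 'cV[R]_m) (x v : 'cV[R]_m).

Lemma Ck_continuous k O F x : Ck_on k O F -> O x -> {for x, continuous F}.
Proof. by case: k => [|k] [cF _]; exact: cF. Qed.

Lemma Ck_derivable k O F i x : Ck_on k.+1 O F -> O x -> derivable F x (delta_mx i 0).
Proof. by case=> _ /(_ i)[dF _]; exact: dF. Qed.

Lemma Ck_pd k O F i : Ck_on k.+1 O F -> Ck_on k O (pd F i).
Proof. by case=> _ /(_ i)[]. Qed.

Lemma CkW k O F : Ck_on k.+1 O F -> Ck_on k O F.
Proof.
elim: k F => [|k IH] F [cF dF]; split=> // i.
by have [dFi /IH CFi] := dF i.
Qed.

Lemma continuous_eq_on O F G x : open O -> O x -> (forall y, O y -> F y = G y) ->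
  {for x, continuous F} -> {for x, continuous G}.
Proof.
move=> oO Ox FG cF; have : G @ x --> F x; last by rewrite FG.
apply: (@cvg_trans _ (F @ x)) => //; apply: (@near_eq_cvg _ _ (nbhs x)).
by near=> y; rewrite FG//; near: y; exact: open_nbhs_nbhs.
Unshelve. all: by end_near. Qed.

(** The definition of C^k iterates partial derivatives of functions on the whole
space, while sums and products have computable derivatives only on O; this
locality makes the inductions below possible. *)
Lemma Ck_eq k O F G : open O -> (forall x, O x -> F x = G x) ->
  Ck_on k O F -> Ck_on k O G.
Proof.
move=> oO; elim: k F G => [|k IH] F G FG [cF dF]; split.
- by move=> x Ox; exact: (continuous_eq_on oO Ox FG (cF x Ox)).
- by [].
- by move=> x Ox; exact: (continuous_eq_on oO Ox FG (cF x Ox)).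
- move=> i; have [dFi CFi] := dF i; split=> [x Ox|].
    exact: (derivable_eq_on oO Ox FG (dFi x Ox)).
  by apply: (IH _ _ _ CFi) => x Ox; exact: pd_eq_on oO Ox FG.
Qed.

Lemma Ck_cst k O (c : R) : Ck_on k O (fun=> c).
Proof.
elim: k c => [|k IH] c; split=> //; try by move=> x _; exact: cst_continuous.
move=> i; split=> [x _|]; first exact: derivable_cst.
have -> : pd (fun=> c) i = (fun=> 0) :> ('cV[R]_m -> R).
  by apply/funext => x; rewrite pd_cst.
exact: IH.
Qed.

Lemma Ck_coord k O (i : 'I_m) : Ck_on k O (fun y => y i 0).
Proof.
case: k => [|k]; split=> //; try by move=> x _; exact: coord_continuous.
move=> j; split=> [x _|]; first exact: derivable_coord.
have -> : pd (fun y => y i 0) j = (fun=> (i == j)%:R) :> ('cV[R]_m -> R).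
  by apply/funext => x; rewrite pd_coord.
exact: Ck_cst.
Qed.

Lemma CkD k O F G : open O -> Ck_on k O F -> Ck_on k O G ->
  Ck_on k O (fun x => F x + G x).
Proof.
move=> oO; elim: k F G => [|k IH] F G CF CG; split=> //; try (
  move=> x Ox; apply: (@continuousD _ _ _ F G);
    [exact: Ck_continuous CF Ox|exact: Ck_continuous CG Ox]).
move=> i; split=> [x Ox|].
  by apply: (@derivableD _ _ _ F G); [exact: Ck_derivable CF Ox|exact: Ck_derivable CG Ox].
apply: (Ck_eq oO _ (IH _ _ (Ck_pd i CF) (Ck_pd i CG))) => // x Ox.
by rewrite pdD//; [exact: Ck_derivable CF Ox|exact: Ck_derivable CG Ox].
Qed.

Lemma CkM k O F G : open O -> Ck_on k O F -> Ck_on k O G ->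
  Ck_on k O (fun x => F x * G x).
Proof.
move=> oO; elim: k F G => [|k IH] F G CF CG; split=> //; try (
  move=> x Ox; apply: (@continuousM _ _ F G);
    [exact: Ck_continuous CF Ox|exact: Ck_continuous CG Ox]).
move=> i; split=> [x Ox|].
  by apply: (@derivableM _ _ F G); [exact: Ck_derivable CF Ox|exact: Ck_derivable CG Ox].
apply: (@Ck_eq k _ (fun x => pd F i x * G x + F x * pd G i x)) => // [x Ox|].
  by rewrite pdM//; [exact: Ck_derivable CF Ox|exact: Ck_derivable CG Ox].
by apply: CkD => //; apply: IH => //; [exact: Ck_pd|exact: CkW|exact: CkW|exact: Ck_pd].
Qed.

Lemma smooth_eq O F G : open O -> (forall x, O x -> F x = G x) ->
  smooth_on O F -> smooth_on O G.
Proof. by move=> oO FG sF k; exact: Ck_eq oO FG (sF k). Qed.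

Lemma smooth_derivable O F i x : smooth_on O F -> O x -> derivable F x (delta_mx i 0).
Proof. by move=> sF; exact: Ck_derivable (sF 1). Qed.

Lemma smooth_pd O F i : smooth_on O F -> smooth_on O (pd F i).
Proof. by move=> sF k; exact: Ck_pd (sF k.+1). Qed.

Lemma smooth_cst O (c : R) : smooth_on O (fun=> c).
Proof. by move=> k; exact: Ck_cst. Qed.

Lemma smooth_coord O (i : 'I_m) : smooth_on O (fun y => y i 0).
Proof. by move=> k; exact: Ck_coord. Qed.

Lemma smoothD O F G : open O -> smooth_on O F -> smooth_on O G ->
  smooth_on O (fun x => F x + G x).
Proof. by move=> oO sF sG k; exact: CkD. Qed.

Lemma smoothM O F G : open O -> smooth_on O F -> smooth_on O G ->
  smooth_on O (fun x => F x * G x).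
Proof. by move=> oO sF sG k; exact: CkM. Qed.

Lemma smooth_sum (I : Type) (r : seq I) O (F : I -> 'cV[R]_m -> R) : open O ->
  (forall i, smooth_on O (F i)) -> smooth_on O (fun x => \sum_(i <- r) F i x).
Proof.
move=> oO sF; elim: r => [|i r IH].
  by apply: (@smooth_eq _ (fun=> 0)) => // [x _|]; [rewrite big_nil|exact: smooth_cst].
apply: (@smooth_eq _ (fun x => F i x + \sum_(i <- r) F i x)) => // [x _|].
  by rewrite big_cons.
exact: smoothD.
Qed.

End Smoothness.

(** * Symmetry of second derivatives *)

Section Schwarz.
Context {R : realType} {m : nat}.
Implicit Types (F G : 'cV[R]_m -> R) (O A : set 'cV[R]_m) (x y v w : 'cV[R]_m).

Lemma line_quotient F v y (c : R) :
  (fun h : R => h^-1 *: (((fun t => F (t *: v + y)) \o shift c) (h *: 1) - F (c *: v + y))) =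
  (fun h : R => h^-1 *: ((F \o shift (c *: v + y)) (h *: v) - F (c *: v + y))).
Proof.
by apply/funext => h /=; rewrite [h *: 1]mulr1 scalerDl addrA.
Qed.

Lemma is_derive_line F v y (c : R) : derivable F (c *: v + y) v ->
  is_derive c 1 (fun t : R => F (t *: v + y)) ('D_v F (c *: v + y)).
Proof.
move=> dF; apply: DeriveDef; first by rewrite /derivable line_quotient.
by rewrite /derive line_quotient.
Qed.

Lemma MVT_line F v y (k : R) : 0 < k ->
    (forall t, 0 <= t <= k -> derivable F (t *: v + y) v) ->
  exists2 c, 0 < c < k & F (k *: v + y) - F y = 'D_v F (c *: v + y) * k.
Proof.
move=> k0 dF.
have [||c ck /=] := @MVT R (fun t => F (t *: v + y)) (fun t => 'D_v F (t *: v + y)) _ _ k0.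
- move=> t; rewrite in_itv/= => /andP[t0 tk]; apply: is_derive_line.
  by apply: dF; rewrite !ltW.
- apply: derivable_within_continuous => t; rewrite in_itv/= => tk.
  by have [] := is_derive_line (dF t tk).
by rewrite scale0r add0r subr0 => ->; exists c.
Qed.

(** The mean value theorem is applied to y |-> F(k w + y) - F(y) along v and then
to D_v F along w. *)
Lemma mixed_difference F v w x (k : R) A : 0 < k ->
    (forall s t, 0 <= s <= k -> 0 <= t <= k -> A (s *: v + (t *: w + x))) ->
    (forall y, A y -> derivable F y v) ->
    (forall y, A y -> derivable ('D_v F) y w) ->
  exists2 y, A y & F (k *: v + (k *: w + x)) - F (k *: w + x) -
                   (F (k *: v + x) - F x) = 'D_w ('D_v F) y * k * k.
Proof.
move=> k0 Ak dF ddF; have kk : 0 <= k <= k by rewrite ltW//=.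
have k00 : 0 <= (0:R) <= k by rewrite lexx ltW.
pose G y := F (k *: w + y) + (-1) * F y.
have dG t : 0 <= t <= k ->
    is_derive (t *: v + x) v G ('D_v F (k *: w + (t *: v + x)) + (-1) * 'D_v F (t *: v + x)).
  move=> tk.
  have d1 : derivable F (k *: w + (t *: v + x)) v.
    by apply: dF; rewrite addrCA; exact: Ak.
  have d2 : derivable F (t *: v + x) v.
    by apply: dF; have := Ak t 0 tk k00; rewrite scale0r add0r.
  have e1 : is_derive (t *: v + x) v (fun y => F (k *: w + y)) ('D_v F (k *: w + (t *: v + x))).
    have E : (fun h : R => h^-1 *: (((fun y => F (k *: w + y)) \o shift (t *: v + x)) (h *: v)
                - F (k *: w + (t *: v + x)))) =
             (fun h : R => h^-1 *: ((F \o shift (k *: w + (t *: v + x))) (h *: v)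
                - F (k *: w + (t *: v + x)))).
      by apply/funext => h /=; rewrite [in LHS]addrCA.
    by apply: DeriveDef; [rewrite /derivable E|rewrite /derive E].
  have e2 := derivableP d2.
  exact: (is_deriveD e1 (is_deriveZ (-1) e2)).
have [t tk|c ck] := @MVT_line G v x k k0; first by have [] := dG t tk.
have {}ck : 0 <= c <= k by move/andP: ck => [/ltW -> /ltW ->].
have [_ ->] := dG c ck.
have [t tk|d dk] := @MVT_line ('D_v F) w (c *: v + x) k k0.
  by apply: ddF; rewrite addrCA; exact: Ak.
have {}dk : 0 <= d <= k by move/andP: dk => [/ltW -> /ltW ->].
rewrite /G !mulN1r => -> E; exists (d *: w + (c *: v + x)).
  by rewrite addrCA; exact: Ak.
by rewrite -E addrCA; lra.
Qed.

Lemma mixed_pd_difference F i j x (k : R) A (v := delta_mx i 0) (w := delta_mx j 0) :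
    0 < k ->
    (forall s t, 0 <= s <= k -> 0 <= t <= k -> A (s *: v + (t *: w + x))) ->
    (forall y, A y -> derivable F y v) ->
    (forall y, A y -> derivable (pd F i) y w) ->
  exists2 y, A y & F (k *: v + (k *: w + x)) - F (k *: w + x) -
                   (F (k *: v + x) - F x) = pd (pd F i) j y * k * k.
Proof. exact: mixed_difference. Qed.

(** The second difference of F over a square of side k is symmetric in the two
directions and equals k^2 times either mixed derivative at some point of the
square; both points tend to x with k. *)
Lemma schwarz O F i j x : open O -> O x -> Ck_on 2 O F ->
  pd (pd F i) j x = pd (pd F j) i x.
Proof.
move=> oO Ox CF; apply/eqP; rewrite eq_le.
have Fle (a b : R) : (forall e, 0 < e -> a < b + e + e) -> a <= b.
  move=> H; apply/ler_addgt0Pr => e e0; have e2 : 0 < e / 2 by rewrite divr_gt0.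
  by have := H _ e2; rewrite -addrA -splitr => /ltW.
suff H i' j' : pd (pd F i') j' x <= pd (pd F j') i' x by apply/andP; split; exact: H.
apply: Fle => e e0.
set v : 'cV[R]_m := delta_mx i' 0; set w : 'cV[R]_m := delta_mx j' 0.
have C1 := Ck_continuous (Ck_pd j' (Ck_pd i' CF)) Ox.
have C2 := Ck_continuous (Ck_pd i' (Ck_pd j' CF)) Ox.
pose A := O `&` [set y | `|pd (pd F i') j' x - pd (pd F i') j' y| < e] `&`
          [set y | `|pd (pd F j') i' x - pd (pd F j') i' y| < e].
have /nbhs_ballP[r /= r0 rA] : nbhs x A.
  apply: filterI; first apply: filterI.
  - exact: open_nbhs_nbhs.
  - by move/cvgrPdist_lt : C1 => /(_ _ e0).
  - by move/cvgrPdist_lt : C2 => /(_ _ e0).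
have [k k0 kr] : exists2 k, 0 < k & k * (`|v| + `|w|) < r.
  have n0 : 0 < 1 + `|v| + `|w| by have := normr_ge0 v; have := normr_ge0 w; lra.
  exists (r / 2 / (1 + `|v| + `|w|)); first by rewrite !divr_gt0.
  rewrite mulrAC ltr_pdivrMr//; have := normr_ge0 v; have := normr_ge0 w; nra.
have Ak s t : 0 <= s <= k -> 0 <= t <= k -> A (s *: v + (t *: w + x)).
  move=> /andP[s0 sk] /andP[t0 tk]; apply: rA; rewrite -ball_normE/=.
  rewrite addrA opprD addrCA subrr addr0 normrN.
  apply: (le_lt_trans (ler_normD _ _)); rewrite !normrZ !ger0_norm//.
  apply: le_lt_trans kr; rewrite mulrDr.
  by apply: lerD; apply: ler_wpM2r.
have [//|||y Ay E1] := @mixed_pd_difference F i' j' x k A k0.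
- by move=> y [[Oy _] _]; exact: Ck_derivable CF Oy.
- by move=> y [[Oy _] _]; exact: Ck_derivable (Ck_pd i' CF) Oy.
have [s t sk tk|||z Az E2] := @mixed_pd_difference F j' i' x k A k0.
- by rewrite addrCA; exact: Ak.
- by move=> y' [[Oy _] _]; exact: Ck_derivable CF Oy.
- by move=> y' [[Oy _] _]; exact: Ck_derivable (Ck_pd j' CF) Oy.
have E : pd (pd F i') j' y = pd (pd F j') i' z.
  move: E1 E2; rewrite (addrCA (k *: delta_mx i' 0)).
  move: (pd (pd F i') j' y) (pd (pd F j') i' z) => p q E1 E2.
  have kn0 : k != 0 by rewrite gt_eqF.
  apply: (mulIf kn0); apply: (mulIf kn0); rewrite -E1 -E2.
  by rewrite -!addrA; congr (_ + _); rewrite !opprB addrCA [RHS]addrCA [- _ - _]addrC.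
have [[_ /= A1] _] := Ay; have [_ /= A2] := Az.
move: E A1 A2; move: (pd (pd F i') j' y) (pd (pd F j') i' z).
move: (pd (pd F i') j' x) (pd (pd F j') i' x) => a b p q ->.
by rewrite !ltr_norml => /andP[a1 a2] /andP[b1 b2]; clear -a1 a2 b1 b2; lra.
Qed.

End Schwarz.

(** * Matrix-valued functions *)

(** Makes the rules for constant directions apply to vector fields. *)
Lemma vact_at (R : realType) m (X : 'cV[R]_m -> 'cV[R]_m) F x :
  vact X F x = vact (fun=> X x) F x.
Proof. by []. Qed.

Section MatrixCalculus.
Context {R : realType} {m : nat}.
Implicit Types (F G : 'cV[R]_m -> R) (O : set 'cV[R]_m) (x v w : 'cV[R]_m).

Lemma pd_sum (I : Type) (r : seq I) O (F : I -> 'cV[R]_m -> R) i x : open O -> O x ->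
  (forall k, smooth_on O (F k)) ->
  pd (fun y => \sum_(k <- r) F k y) i x = \sum_(k <- r) pd (F k) i x.
Proof.
move=> oO Ox sF; elim: r => [|k r IH].
  rewrite big_nil -[RHS](pd_cst 0 i x); congr (pd _ i x).
  by apply/funext => y; rewrite big_nil.
rewrite big_cons -IH -(pdD (smooth_derivable (sF k) Ox)).
  by congr (pd _ i x); apply/funext => y; rewrite big_cons.
exact: smooth_derivable (smooth_sum r oO sF) Ox.
Qed.

Lemma vact_eq_on O F G (X : 'cV[R]_m -> 'cV[R]_m) x : open O -> O x ->
  (forall y, O y -> F y = G y) -> vact X F x = vact X G x.
Proof. by move=> oO Ox FG; apply: eq_bigr => i _; rewrite (pd_eq_on _ oO Ox FG). Qed.

Lemma vact_cst (X : 'cV[R]_m -> 'cV[R]_m) (c : R) x : vact X (fun=> c) x = 0.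
Proof. by rewrite /vact big1// => i _; rewrite pd_cst mulr0. Qed.

Lemma vactD O F G X x : O x -> smooth_on O F -> smooth_on O G ->
  vact X (fun y => F y + G y) x = vact X F x + vact X G x.
Proof.
move=> Ox sF sG; rewrite /vact -big_split/=; apply: eq_bigr => i _.
by rewrite pdD ?mulrDr//; [exact: smooth_derivable sF Ox|exact: smooth_derivable sG Ox].
Qed.

Lemma vactM O F G X x : O x -> smooth_on O F -> smooth_on O G ->
  vact X (fun y => F y * G y) x = vact X F x * G x + F x * vact X G x.
Proof.
move=> Ox sF sG; rewrite /vact mulr_suml mulr_sumr -big_split/=; apply: eq_bigr => i _.
rewrite pdM; [by ring|exact: smooth_derivable sF Ox|exact: smooth_derivable sG Ox].
Qed.

Lemma vact_sum (I : Type) (r : seq I) O (F : I -> 'cV[R]_m -> R) X x : open O -> O x ->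
  (forall k, smooth_on O (F k)) ->
  vact X (fun y => \sum_(k <- r) F k y) x = \sum_(k <- r) vact X (F k) x.
Proof.
move=> oO Ox sF; rewrite /vact exchange_big/=; apply: eq_bigr => i _.
by rewrite (pd_sum r i oO Ox sF) mulr_sumr.
Qed.

(** The direction is a vector rather than a vector field, so that this is linear
in v by construction and covers both Lie derivatives along a field, as
pdir (X x) F x, and derivatives along fibres. *)
Definition pdir p q v (F : 'cV[R]_m -> 'M[R]_(p, q)) x : 'M[R]_(p, q) :=
  \matrix_(i, j) vact (fun=> v) (fun y => F y i j) x.

Lemma pdir_addv p q v w (F : 'cV[R]_m -> 'M[R]_(p, q)) x :
  pdir (v + w) F x = pdir v F x + pdir w F x.
Proof.
apply/matrixP => i j; rewrite !mxE /vact -big_split/=; apply: eq_bigr => k _.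
by rewrite mxE mulrDl.
Qed.

Lemma pdir_scalev p q (a : R) v (F : 'cV[R]_m -> 'M[R]_(p, q)) x :
  pdir (a *: v) F x = a *: pdir v F x.
Proof.
apply/matrixP => i j; rewrite !mxE /vact mulr_sumr; apply: eq_bigr => k _.
by rewrite mxE mulrA.
Qed.

Lemma pdir0v p q (F : 'cV[R]_m -> 'M[R]_(p, q)) x : pdir 0 F x = 0.
Proof. by rewrite -(scale0r 0) pdir_scalev scale0r. Qed.

Lemma pdir_jac p v (F : 'cV[R]_m -> 'cV[R]_p) x : pdir v F x = jac F x *m v.
Proof.
apply/matrixP => i j; rewrite ord1 !mxE; apply: eq_bigr => k _.
by rewrite mxE mulrC.
Qed.

Lemma pdir_eq_on p q O v (F G : 'cV[R]_m -> 'M[R]_(p, q)) x : open O -> O x ->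
  (forall y, O y -> F y = G y) -> pdir v F x = pdir v G x.
Proof.
move=> oO Ox FG; apply/matrixP => i j; rewrite !mxE.
by apply: (vact_eq_on _ oO Ox) => y Oy; rewrite FG.
Qed.

Lemma pdir_cst p q v (A : 'M[R]_(p, q)) x : pdir v (fun=> A) x = 0.
Proof. by apply/matrixP => i j; rewrite !mxE vact_cst. Qed.

Lemma pdir_id v x : pdir v id x = v.
Proof.
apply/matrixP => i j; rewrite ord1 !mxE /vact (bigD1 i)//= pd_coord eqxx mulr1.
by rewrite big1 ?addr0// => k ki; rewrite pd_coord eq_sym (negbTE ki) mulr0.
Qed.

Lemma pdir_tr p q v (F : 'cV[R]_m -> 'M[R]_(p, q)) x :
  pdir v (fun y => (F y)^T) x = (pdir v F x)^T.
Proof.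
apply/matrixP => i j; rewrite !mxE; congr (vact _ _ _).
by apply/funext => y; rewrite mxE.
Qed.

Lemma pdirD p q O v (F G : 'cV[R]_m -> 'M[R]_(p, q)) x : O x ->
  smooth_mx_on O F -> smooth_mx_on O G ->
  pdir v (fun y => F y + G y) x = pdir v F x + pdir v G x.
Proof.
move=> Ox sF sG; apply/matrixP => i j; rewrite !mxE -(vactD _ Ox (sF i j) (sG i j)).
by congr (vact _ _ _); apply/funext => y; rewrite mxE.
Qed.

Lemma pdirM p q r O v (F : 'cV[R]_m -> 'M[R]_(p, q)) (G : 'cV[R]_m -> 'M[R]_(q, r)) x :
  open O -> O x -> smooth_mx_on O F -> smooth_mx_on O G ->
  pdir v (fun y => F y *m G y) x = pdir v F x *m G x + F x *m pdir v G x.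
Proof.
move=> oO Ox sF sG; apply/matrixP => i j; rewrite !mxE -big_split/=.
transitivity (vact (fun=> v) (fun y => \sum_k F y i k * G y k j) x).
  by congr (vact _ _ _); apply/funext => y; rewrite mxE.
rewrite (vact_sum _ _ oO Ox) => [|k]; last exact: smoothM.
by apply: eq_bigr => k _; rewrite (vactM _ Ox (sF i k) (sG k j)) !mxE.
Qed.

Lemma pdirZ p q O (a : R) v (F : 'cV[R]_m -> 'M[R]_(p, q)) x :
  O x -> smooth_mx_on O F -> pdir v (fun y => a *: F y) x = a *: pdir v F x.
Proof.
move=> Ox sF; apply/matrixP => i j; rewrite !mxE.
transitivity (vact (fun=> v) (fun y => a * F y i j) x).
  by congr (vact _ _ _); apply/funext => y; rewrite mxE.
by rewrite (vactM _ Ox (smooth_cst _ a) (sF i j)) vact_cst mul0r add0r.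
Qed.

Lemma pdirN p q O v (F : 'cV[R]_m -> 'M[R]_(p, q)) x :
  O x -> smooth_mx_on O F -> pdir v (fun y => - F y) x = - pdir v F x.
Proof.
move=> Ox sF; rewrite -scaleN1r -(pdirZ _ _ Ox sF).
by congr (pdir _ _ _); apply/funext => y; rewrite scaleN1r.
Qed.

Lemma pdir_mxsub p q p' q' (f : 'I_p' -> 'I_p) (h : 'I_q' -> 'I_q) v
  (F : 'cV[R]_m -> 'M[R]_(p, q)) x :
  pdir v (fun y => mxsub f h (F y)) x = mxsub f h (pdir v F x).
Proof.
apply/matrixP => i j; rewrite !mxE; congr (vact _ _ _).
by apply/funext => y; rewrite mxE.
Qed.

Lemma smx_cst p q O (A : 'M[R]_(p, q)) : smooth_mx_on O (fun=> A).
Proof. by move=> i j; exact: smooth_cst. Qed.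

Lemma smx_id O : smooth_mx_on O id.
Proof. by move=> i j; rewrite ord1; exact: smooth_coord. Qed.

Lemma smx_entries p q O (F : 'cV[R]_m -> 'M[R]_(p, q)) (E : 'I_p -> 'I_q -> 'cV[R]_m -> R) :
  (forall y i j, F y i j = E i j y) -> (forall i j, smooth_on O (E i j)) ->
  smooth_mx_on O F.
Proof.
move=> FE sE i j; have -> : (fun y => F y i j) = E i j by apply/funext => y; rewrite FE.
exact: sE.
Qed.

Lemma smx_eq p q O (F G : 'cV[R]_m -> 'M[R]_(p, q)) : open O ->
  (forall y, O y -> F y = G y) -> smooth_mx_on O F -> smooth_mx_on O G.
Proof. by move=> oO FG sF i j; apply: (smooth_eq oO) (sF i j) => y Oy; rewrite FG. Qed.

Lemma smxD p q O (F G : 'cV[R]_m -> 'M[R]_(p, q)) : open O ->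
  smooth_mx_on O F -> smooth_mx_on O G -> smooth_mx_on O (fun y => F y + G y).
Proof.
move=> oO sF sG; apply: (@smx_entries _ _ _ _ (fun i j y => F y i j + G y i j)).
  by move=> y i j; rewrite mxE.
by move=> i j; exact: smoothD.
Qed.

Lemma smxM p q r O (F : 'cV[R]_m -> 'M[R]_(p, q)) (G : 'cV[R]_m -> 'M[R]_(q, r)) :
  open O -> smooth_mx_on O F -> smooth_mx_on O G ->
  smooth_mx_on O (fun y => F y *m G y).
Proof.
move=> oO sF sG; apply: (@smx_entries _ _ _ _ (fun i j y => \sum_k F y i k * G y k j)).
  by move=> y i j; rewrite mxE.
by move=> i j; apply: smooth_sum => // k; exact: smoothM.
Qed.

Lemma smxZ p q O (a : R) (F : 'cV[R]_m -> 'M[R]_(p, q)) : open O ->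
  smooth_mx_on O F -> smooth_mx_on O (fun y => a *: F y).
Proof.
move=> oO sF; apply: (@smx_entries _ _ _ _ (fun i j y => a * F y i j)).
  by move=> y i j; rewrite mxE.
by move=> i j; apply: smoothM => //; exact: smooth_cst.
Qed.

Lemma smxN p q O (F : 'cV[R]_m -> 'M[R]_(p, q)) : open O ->
  smooth_mx_on O F -> smooth_mx_on O (fun y => - F y).
Proof.
move=> oO sF; apply: (smx_eq oO) (smxZ (-1) oO sF) => y _.
by rewrite scaleN1r.
Qed.

Lemma smxB p q O (F G : 'cV[R]_m -> 'M[R]_(p, q)) : open O ->
  smooth_mx_on O F -> smooth_mx_on O G -> smooth_mx_on O (fun y => F y - G y).
Proof. by move=> oO sF sG; apply: smxD => //; exact: smxN. Qed.

Lemma pdirB p q O v (F G : 'cV[R]_m -> 'M[R]_(p, q)) x : open O -> O x ->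
  smooth_mx_on O F -> smooth_mx_on O G ->
  pdir v (fun y => F y - G y) x = pdir v F x - pdir v G x.
Proof. by move=> oO Ox sF sG; rewrite (pdirD _ Ox sF (smxN oO sG)) (pdirN _ Ox sG). Qed.

Lemma smx_tr p q O (F : 'cV[R]_m -> 'M[R]_(p, q)) :
  smooth_mx_on O F -> smooth_mx_on O (fun y => (F y)^T).
Proof.
move=> sF; apply: (@smx_entries _ _ _ _ (fun i j y => F y j i)) => //.
by move=> y i j; rewrite mxE.
Qed.

Lemma smx_mxsub p q p' q' (f : 'I_p' -> 'I_p) (h : 'I_q' -> 'I_q) O
    (F : 'cV[R]_m -> 'M[R]_(p, q)) :
  smooth_mx_on O F -> smooth_mx_on O (fun y => mxsub f h (F y)).
Proof.
move=> sF; apply: (@smx_entries _ _ _ _ (fun i j y => F y (f i) (h j))) => //.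
by move=> y i j; rewrite mxE.
Qed.

Lemma smx_pdir p q O (V : 'cV[R]_m -> 'cV[R]_m) (F : 'cV[R]_m -> 'M[R]_(p, q)) :
  open O -> smooth_mx_on O V -> smooth_mx_on O F ->
  smooth_mx_on O (fun y => pdir (V y) F y).
Proof.
move=> oO sV sF.
apply: (@smx_entries _ _ _ _ (fun i j y => \sum_k V y k 0 * pd (fun y' => F y' i j) k y)).
  by move=> y i j; rewrite mxE.
by move=> i j; apply: smooth_sum => // k; apply: smoothM => //; exact: smooth_pd.
Qed.

Lemma smx_d0 O F : smooth_on O F -> smooth_mx_on O (d0 F).
Proof.
move=> sF; apply: (@smx_entries _ _ _ _ (fun i j => pd F j)).
  by move=> y i j; rewrite mxE.
by move=> i j; exact: smooth_pd.
Qed.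

Lemma smx_d1 O (al : 'cV[R]_m -> 'rV[R]_m) : open O ->
  smooth_mx_on O al -> smooth_mx_on O (d1 al).
Proof.
move=> oO sal; apply: (@smx_entries _ _ _ _ (fun i j x =>
    pd (fun y => al y 0 j) i x + (-1) * pd (fun y => al y 0 i) j x)).
  by move=> y i j; rewrite mxE mulN1r.
move=> i j; apply: smoothD => //; first exact: smooth_pd.
by apply: smoothM => //; [exact: smooth_cst|exact: smooth_pd].
Qed.

End MatrixCalculus.

Lemma pdir_pdir_sym (R : realType) m p q (O : set 'cV[R]_m) v w (F : 'cV[R]_m -> 'M[R]_(p, q)) x :
  open O -> O x -> smooth_mx_on O F -> pdir v (pdir w F) x = pdir w (pdir v F) x.
Proof.
move=> oO Ox sF; apply/matrixP => i j.
have E v' w' : pdir v' (pdir w' F) x i j =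
    \sum_k \sum_l v' k 0 * w' l 0 * pd (pd (fun y => F y i j) l) k x.
  rewrite mxE; transitivity (vact (fun=> v') (fun y => \sum_l w' l 0 * pd (fun y => F y i j) l y) x).
    by congr (vact _ _ x); apply/funext => y; rewrite mxE.
  have sp l : smooth_on O (pd (fun y => F y i j) l) by apply: smooth_pd; exact: sF.
  have s l : smooth_on O (fun y => w' l 0 * pd (fun y => F y i j) l y).
    by apply: smoothM => //; exact: smooth_cst.
  rewrite (vact_sum _ _ oO Ox s) /vact exchange_big/=; apply: eq_bigr => k _.
  apply: eq_bigr => l _; rewrite -mulrA; congr (_ * _).
  have d : derivable (pd (fun y => F y i j) l) x (delta_mx k 0) by exact: smooth_derivable (sp l) Ox.
  by rewrite (pdM (derivable_cst _ _ _) d) pd_cst mul0r add0r.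
rewrite !E exchange_big/=; apply: eq_bigr => k _; apply: eq_bigr => l _.
by rewrite (schwarz k l oO Ox (sF i j 2)) [v _ _ * _]mulrC.
Qed.

Lemma pdir_block (R : realType) m p1 p2 q1 q2 v
    (A : 'cV[R]_m -> 'M[R]_(p1, q1)) (B : 'cV[R]_m -> 'M[R]_(p1, q2))
    (C : 'cV[R]_m -> 'M[R]_(p2, q1)) (D : 'cV[R]_m -> 'M[R]_(p2, q2)) x :
  pdir v (fun y => block_mx (A y) (B y) (C y) (D y)) x =
  block_mx (pdir v A x) (pdir v B x) (pdir v C x) (pdir v D x).
Proof.
apply/matrixP => i j; rewrite [LHS]mxE.
case: (split_ordP i) => k ->; case: (split_ordP j) => l ->;
  rewrite ?block_mxEul ?block_mxEur ?block_mxEdl ?block_mxEdr [RHS]mxE;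
  by congr (vact _ _ x); apply/funext => y;
     rewrite ?block_mxEul ?block_mxEur ?block_mxEdl ?block_mxEdr.
Qed.

Lemma vact_bil (R : realType) p q m (O : set 'cV[R]_m) v (M : 'cV[R]_m -> 'M[R]_(p, q)) X Y z :
  open O -> O z -> smooth_mx_on O M -> smooth_mx_on O X -> smooth_mx_on O Y ->
  vact (fun=> v) (fun y => bil (M y) (X y) (Y y)) z =
  bil (pdir v M z) (X z) (Y z) + bil (M z) (pdir v X z) (Y z) + bil (M z) (X z) (pdir v Y z).
Proof.
move=> oO Oz sM sX sY.
transitivity (pdir v (fun y => (X y)^T *m M y *m Y y) z 0 0); first by rewrite mxE.
have sXt := smx_tr sX; have sXM := smxM oO sXt sM.
rewrite (pdirM _ oO Oz sXM sY) (pdirM _ oO Oz sXt sM) pdir_tr mulmxDl !entryD /bil.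
by rewrite [X in X + _ = _]addrC.
Qed.

(** * Lie derivatives and exterior derivatives *)

(* The partial derivative is kept opaque from here on, as failing unification
   problems would otherwise unfold it down to limits of filters. *)
Section Fields.
Local Opaque pd.
Context {R : realType} {m : nat}.
Variable O : set 'cV[R]_m.
Hypothesis oO : open O.
Implicit Types (F G : 'cV[R]_m -> R) (x v w : 'cV[R]_m) (X Y : 'cV[R]_m -> 'cV[R]_m)
  (K : 'cV[R]_m -> 'M[R]_m) (al be : 'cV[R]_m -> 'rV[R]_m).

Lemma bracketE X Y x : bracket X Y x = pdir (X x) Y x - pdir (Y x) X x.
Proof. by apply/matrixP => i j; rewrite ord1 !mxE. Qed.

(** Both brackets differentiate Y along X, and these terms cancel. *)
Lemma lie11E X K Y x : O x -> smooth_mx_on O K -> smooth_mx_on O Y ->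
  lie11 X K Y x = (pdir (X x) K x - jac X x *m K x + K x *m jac X x) *m Y x.
Proof.
move=> Ox sK sY; rewrite /lie11 !bracketE /app (pdirM _ oO Ox sK sY) !pdir_jac.
rewrite mulmxBr !mulmxDl mulNmx !mulmxA; mx_ring.
Qed.

Lemma d1E al i j x : d1 al x i j = pd (fun y => al y 0 j) i x - pd (fun y => al y 0 i) j x.
Proof. by rewrite mxE. Qed.

Lemma d1_anti al i j x : d1 al x i j = - d1 al x j i.
Proof. by rewrite !d1E opprB. Qed.

Lemma bil_d1 al x v w :
  bil (d1 al x) v w = (pdir v al x *m w) 0 0 - (pdir w al x *m v) 0 0.
Proof.
have E v' w' : (pdir v' al x *m w') 0 0 =
    \sum_i \sum_j v' i 0 * pd (fun y => al y 0 j) i x * w' j 0.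
  rewrite mxE exchange_big/=; apply: eq_bigr => j _.
  by rewrite mxE mulr_suml.
rewrite !E [in X in _ = _ - X]exchange_big/= -sumrB /bil -mulmxA mxE.
apply: eq_bigr => i _; rewrite !mxE mulr_sumr -sumrB; apply: eq_bigr => j _.
by rewrite d1E; ring.
Qed.

Lemma d1_eq_on al be x : O x -> (forall y, O y -> al y = be y) -> d1 al x = d1 be x.
Proof.
move=> Ox ab; apply/matrixP => i j; rewrite !d1E.
by congr (_ - _); apply: (pd_eq_on _ oO Ox) => y Oy; rewrite ab.
Qed.

Lemma d1_d0 F x : O x -> smooth_on O F -> d1 (d0 F) x = 0.
Proof.
move=> Ox sF; apply/matrixP => i j; rewrite d1E [RHS]mxE.
have E k : (fun y => d0 F y 0 k) = pd F k by apply/funext => y; rewrite mxE.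
by rewrite !E (schwarz i j oO Ox (sF 2)) subrr.
Qed.

(** This is dd = 0 for 1-forms. *)
Lemma d1_closed al x i j k : O x -> smooth_mx_on O al ->
  pd (fun y => d1 al y k j) i x - pd (fun y => d1 al y k i) j x =
  pd (fun y => d1 al y i j) k x.
Proof.
move=> Ox sal; have s k' : smooth_on O (fun y => al y 0 k') by exact: sal.
have dd a b c : derivable (pd (fun y => al y 0 a) b) x (delta_mx c 0).
  by apply: smooth_derivable Ox; exact: smooth_pd.
have E i' j' k' : pd (fun y => d1 al y i' j') k' x =
   pd (pd (fun y => al y 0 j') i') k' x - pd (pd (fun y => al y 0 i') j') k' x.
  transitivity (pd (fun y => pd (fun y => al y 0 j') i' y + (-1) * pd (fun y => al y 0 i') j' y) k' x).
    by congr (pd _ k' x); apply/funext => y; rewrite d1E mulN1r.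
  rewrite (pdD (dd _ _ _)); last by apply: derivableM; [exact: derivable_cst|exact: dd].
  by rewrite (pdM (derivable_cst _ _ _) (dd _ _ _)) pd_cst mul0r add0r mulN1r.
rewrite !E (schwarz k i oO Ox (s j 2)) (schwarz k j oO Ox (s i 2)).
by rewrite (schwarz j i oO Ox (s k 2)) opprB addrA subrK.
Qed.

(** Cartan's formula for the exact form w = d alpha: as dw = 0, d(i_X w) is the
Lie derivative of w along X. *)
Lemma lie_d1 X al x : O x -> smooth_mx_on O X -> smooth_mx_on O al ->
  d1 (fun y => iprod (X y) (d1 al y)) x =
  pdir (X x) (d1 al) x + (jac X x)^T *m d1 al x + d1 al x *m jac X x.
Proof.
move=> Ox sX sal; have sw := smx_d1 oO sal.
have E i j : pd (fun y => iprod (X y) (d1 al y) 0 j) i x =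
   \sum_k (pd (fun y => X y k 0) i x * d1 al x k j + X x k 0 * pd (fun y => d1 al y k j) i x).
  transitivity (pd (fun y => \sum_k X y k 0 * d1 al y k j) i x).
    congr (pd _ _ _); apply/funext => y; rewrite mxE; apply: eq_bigr => k _.
    by rewrite [_^T 0 k]mxE.
  rewrite (pd_sum _ _ oO Ox); last by move=> k; exact: smoothM.
  apply: eq_bigr => k _; rewrite pdM//.
    exact: smooth_derivable (sX k 0) Ox.
  exact: smooth_derivable (sw k j) Ox.
apply/matrixP => i j; rewrite d1E !E -sumrB !entryD ![(_ *m _) i j]mxE [X in _ = X + _ + _]mxE.
rewrite -!big_split/=; apply: eq_bigr => k _.
rewrite -(d1_closed i j k Ox sal) (d1_anti al i k) [_^T i k]mxE ![jac X x _ _]mxE; ring.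
Qed.

Lemma d1D al be x : O x -> smooth_mx_on O al -> smooth_mx_on O be ->
  d1 (fun y => al y + be y) x = d1 al x + d1 be x.
Proof.
move=> Ox sa sb; apply: bilP => v w.
by rewrite bilE !bil_d1 !(pdirD _ Ox sa sb) !mulmxDl !mxE; ring.
Qed.

Lemma d1N al x : O x -> smooth_mx_on O al -> d1 (fun y => - al y) x = - d1 al x.
Proof.
by move=> Ox sa; apply: bilP => v w; rewrite bilE !bil_d1 !(pdirN _ Ox sa) !mulNmx !mxE; ring.
Qed.

Lemma d1_scale_d0 F G x : O x -> smooth_on O F -> smooth_on O G ->
  d1 (fun y => F y *: d0 G y) x = (d0 F x)^T *m d0 G x - (d0 G x)^T *m d0 F x.
Proof.
move=> Ox sF sG; apply/matrixP => i j.
have E k l : pd (fun y => (F y *: d0 G y) 0 k) l x = pd F l x * pd G k x + F x * pd (pd G k) l x.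
  transitivity (pd (fun y => F y * pd G k y) l x).
    by congr (pd _ _ _); apply/funext => y; rewrite !mxE.
  have dG : derivable (pd G k) x (delta_mx l 0).
    by apply: smooth_derivable Ox; exact: smooth_pd.
  by rewrite (pdM (smooth_derivable sF Ox) dG).
rewrite d1E !E (schwarz i j oO Ox (sG 2)) !mxE !big_ord1 !mxE opprD addrACA subrr addr0.
by rewrite [pd F j x * _]mulrC.
Qed.

Lemma d0_mul F v x : (d0 F x *m v) 0 0 = vact (fun=> v) F x.
Proof. by rewrite mxE; apply: eq_bigr => i _; rewrite mxE mulrC. Qed.

End Fields.

(** * Coordinates on the tangent bundle *)

Section BundleCoordinates.
Context {R : realType} {n : nat}.
Local Notation E := 'cV[R]_(n + n).
Implicit Types (x v w : 'cV[R]_n) (z : E).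

Lemma qc_col v w : qc (col_mx v w) = v. Proof. exact: col_mxKu. Qed.
Lemma uc_col v w : uc (col_mx v w) = w. Proof. exact: col_mxKd. Qed.
Lemma qcuc z : col_mx (qc z) (uc z) = z. Proof. exact: vsubmxK. Qed.
Lemma qcD z z' : qc (z + z') = qc z + qc z'. Proof. exact: linearD. Qed.
Lemma ucD z z' : uc (z + z') = uc z + uc z'. Proof. exact: linearD. Qed.
Lemma qcZ (c : R) z : qc (c *: z) = c *: qc z. Proof. exact: linearZ. Qed.
Lemma ucZ (c : R) z : uc (c *: z) = c *: uc z. Proof. exact: linearZ. Qed.

Lemma qc_continuous : continuous (qc : E -> 'cV[R]_n).
Proof.
move=> z A /= /(nbhs_ballP (qc z)) [e e0 es].
apply/nbhs_ballP; exists e => //= z' [_ zz']; apply: es; split=> // i j.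
by rewrite !mxE; exact: zz'.
Qed.

Lemma open_tangent (O : set 'cV[R]_n) : open O -> open (qc @^-1` O).
Proof. by move=> oO; apply: open_comp => // z _; exact: qc_continuous. Qed.

Lemma quotient_qc (F : 'cV[R]_n -> R) z z' :
  (fun h : R => h^-1 *: (((F \o qc) \o shift z) (h *: z') - (F \o qc) z)) =
  (fun h : R => h^-1 *: ((F \o shift (qc z)) (h *: qc z') - F (qc z))).
Proof. by apply/funext => h /=; rewrite qcD qcZ. Qed.

Lemma pd_qc (F : 'cV[R]_n -> R) (k : 'I_(n + n)) z :
  pd (F \o qc) k z = 'D_(qc (delta_mx k 0)) F (qc z).
Proof. by rewrite [LHS]/pd /derive quotient_qc. Qed.

Lemma derivable_qc (F : 'cV[R]_n -> R) z z' :
  derivable F (qc z) (qc z') -> derivable (F \o qc) z z'.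
Proof. by rewrite /derivable quotient_qc. Qed.

Local Opaque pd.

Lemma qc_lshift (i : 'I_n) : qc (delta_mx (lshift n i) 0) = delta_mx i 0 :> 'cV[R]_n.
Proof. by apply/matrixP => j l; rewrite !mxE (inj_eq (@lshift_inj _ _)). Qed.

Lemma qc_rshift (i : 'I_n) : qc (delta_mx (rshift n i) 0) = 0 :> 'cV[R]_n.
Proof. by apply/matrixP => j l; rewrite !mxE eq_lrshift. Qed.

Lemma pd_qc_l (F : 'cV[R]_n -> R) (i : 'I_n) z : pd (F \o qc) (lshift n i) z = pd F i (qc z).
Proof. by rewrite pd_qc qc_lshift. Qed.

Lemma pd_qc_r (F : 'cV[R]_n -> R) (i : 'I_n) z : pd (F \o qc) (rshift n i) z = 0.
Proof. by rewrite pd_qc qc_rshift derive0. Qed.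

Lemma vact_qc (F : 'cV[R]_n -> R) z' z :
  vact (fun=> z') (F \o qc) z = vact (fun=> qc z') F (qc z).
Proof.
rewrite /vact big_split_ord/= [X in _ + X]big1 ?addr0; last by move=> i _; rewrite pd_qc_r mulr0.
by apply: eq_bigr => i _; rewrite pd_qc_l mxE.
Qed.

Lemma pdir_qc p q z' (F : 'cV[R]_n -> 'M[R]_(p, q)) z :
  pdir z' (fun y => F (qc y)) z = pdir (qc z') F (qc z).
Proof. by apply/matrixP => i j; rewrite !mxE -vact_qc. Qed.

Lemma pdir_qcF z' (F : E -> E) z : pdir z' (fun y => qc (F y)) z = qc (pdir z' F z).
Proof. by rewrite /qc; under eq_fun do rewrite usubmxEsub; rewrite pdir_mxsub usubmxEsub. Qed.

Lemma pdir_ucF z' (F : E -> E) z : pdir z' (fun y => uc (F y)) z = uc (pdir z' F z).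
Proof. by rewrite /uc; under eq_fun do rewrite dsubmxEsub; rewrite pdir_mxsub dsubmxEsub. Qed.

Lemma pdir_uc0 z' z : pdir z' uc z = uc z'.
Proof. by rewrite (pdir_ucF z' id z) pdir_id. Qed.

Lemma smx_uc O : smooth_mx_on O (uc : E -> 'cV[R]_n).
Proof. by rewrite /uc; under eq_fun do rewrite dsubmxEsub; apply: smx_mxsub; exact: smx_id. Qed.

Lemma smx_ucF O (F : E -> E) : smooth_mx_on O F -> smooth_mx_on O (fun y => uc (F y)).
Proof. by rewrite /uc; under eq_fun do rewrite dsubmxEsub; exact: smx_mxsub. Qed.

Section Tube.
Variable O : set 'cV[R]_n.
Hypothesis oO : open O.
Local Notation W := (qc @^-1` O : set E).

Lemma smooth_qc (F : 'cV[R]_n -> R) : smooth_on O F -> smooth_on W (F \o qc).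
Proof.
move=> sF k; move: (sF k); elim: k F {sF} => [|k IH] F CF; split=> //; try (
  move=> z Oz; apply: continuous_comp; [exact: qc_continuous|exact: Ck_continuous CF Oz]).
move=> i; case: (split_ordP i) => j ->; split.
- move=> z Oz; apply: derivable_qc; rewrite qc_lshift; exact: Ck_derivable CF Oz.
- rewrite (_ : pd _ _ = pd F j \o qc); last by apply/funext => z; rewrite pd_qc_l.
  by apply: IH; exact: Ck_pd.
- by move=> z Oz; apply: derivable_qc; rewrite qc_rshift; exact: derivable0.
- rewrite (_ : pd _ _ = fun=> 0); last by apply/funext => z; rewrite pd_qc_r.
  exact: Ck_cst.
Qed.

Lemma smx_qc p q (F : 'cV[R]_n -> 'M[R]_(p, q)) :
  smooth_mx_on O F -> smooth_mx_on W (fun y => F (qc y)).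
Proof. by move=> sF i j; exact: smooth_qc (sF i j). Qed.

Lemma smx_pdir_uc p q (F : 'cV[R]_n -> 'M[R]_(p, q)) :
  smooth_mx_on O F -> smooth_mx_on W (fun z => pdir (uc z) F (qc z)).
Proof.
move=> sF; have oW := open_tangent oO.
apply: (@smx_entries _ _ _ _ _ _ (fun i j z =>
    \sum_k uc z k 0 * (pd (fun x => F x i j) k \o qc) z)).
  by move=> z i j; rewrite mxE.
move=> i j; apply: smooth_sum => // k; apply: smoothM => //.
  exact: (@smx_uc W).
by apply: smooth_qc; exact: smooth_pd (sF i j).
Qed.

(** The matrix dF(u) is linear in u, so its fibre derivative is dF itself. *)
Lemma pdir_pdir_uc p q v (F : 'cV[R]_n -> 'M[R]_(p, q)) z : W z -> smooth_mx_on O F ->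
  pdir (col_mx 0 v) (fun y => pdir (uc y) F (qc y)) z = pdir v F (qc z).
Proof.
move=> Wz sF; have oW := open_tangent oO; apply/matrixP => i j; rewrite [LHS]mxE.
transitivity (vact (fun=> col_mx 0 v) (fun y => \sum_k uc y k 0 * pd (fun x => F x i j) k (qc y)) z).
  by congr (vact _ _ z); apply/funext => y; rewrite mxE.
have su k : smooth_on W (fun y : E => uc y k 0) by apply: smx_uc.
have sp k : smooth_on W (fun y : E => pd (fun x => F x i j) k (qc y)).
  by apply: smooth_qc; exact: smooth_pd (sF i j).
rewrite (vact_sum _ _ oW Wz); last by move=> k; exact: smoothM.
rewrite [RHS]mxE; apply: eq_bigr => k _; rewrite (vactM _ Wz (su k) (sp k)).
rewrite [X in _ + _ * X](_ : _ = 0); last first.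
  rewrite -[LHS]/(vact _ (pd (fun x => F x i j) k \o qc) z) vact_qc qc_col /vact.
  by rewrite big1// => l _; rewrite mxE mul0r.
rewrite mulr0 addr0; congr (_ * _).
by have /matrixP/(_ k 0) := pdir_uc0 (col_mx 0 v) z; rewrite [LHS]mxE uc_col.
Qed.

End Tube.

End BundleCoordinates.

(** * The geodesic spray and its connection *)

Section Lagrangian.
Local Opaque pd.
Context {R : realType} {n : nat}.
Local Notation E := 'cV[R]_(n + n).
Variable O : set 'cV[R]_n.
Hypothesis oO : open O.
Local Notation W := (qc @^-1` O : set E).
Let oW : open W := open_tangent oO.
Implicit Types (v w : 'cV[R]_n) (z : E) (N : 'cV[R]_n -> 'M[R]_n).

Lemma vertS_mul z : vertS *m z = col_mx 0 (qc z).
Proof. by rewrite -[z in LHS]qcuc /vertS mul_block_col !mul0mx mul1mx !addr0. Qed.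

Definition fibre_prj : 'M[R]_(n, n + n) := row_mx 1%:M 0.

Lemma fibre_prjE z : fibre_prj *m z = qc z.
Proof. by rewrite -[z in LHS]qcuc mul_row_col mul1mx mul0mx addr0. Qed.

(** The 1-form N_ij u^i dq^j; it is theta_L for N = g and d_{J^c S} L for N = gJ. *)
Definition semibasic N z : 'rV[R]_(n + n) := (uc z)^T *m N (qc z) *m fibre_prj.

Lemma smx_semibasic N : smooth_mx_on O N -> smooth_mx_on W (semibasic N).
Proof.
move=> sN; apply: (smxM oW _ (smx_cst _ _)).
by apply: (smxM oW); [apply: smx_tr; exact: smx_uc|exact: smx_qc].
Qed.

Lemma semibasicE N z z' : (semibasic N z *m z') 0 0 = bil (N (qc z)) (uc z) (qc z').
Proof. by rewrite /semibasic -mulmxA fibre_prjE. Qed.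

Lemma pdir_semibasic N z z' z'' : smooth_mx_on O N -> W z ->
  (pdir z' (semibasic N) z *m z'') 0 0 =
  bil (N (qc z)) (uc z') (qc z'') + bil (pdir (qc z') N (qc z)) (uc z) (qc z'').
Proof.
move=> sN Wz; have sut : smooth_mx_on W (fun y : E => (uc y)^T) by apply: smx_tr; exact: smx_uc.
have sNq := smx_qc sN; have suN := smxM oW sut sNq.
rewrite /semibasic (pdirM _ oW Wz suN (smx_cst _ _)) pdir_cst mulmx0 addr0.
rewrite (pdirM _ oW Wz sut sNq) pdir_tr pdir_uc0 pdir_qc -mulmxA fibre_prjE.
by rewrite mulmxDl entryD.
Qed.

Lemma bil_d1_semibasic N z z' z'' : smooth_mx_on O N -> W z ->
  bil (d1 (semibasic N) z) z' z'' =
  bil (N (qc z)) (uc z') (qc z'') - bil (N (qc z)) (uc z'') (qc z') +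
  (bil (pdir (qc z') N (qc z)) (uc z) (qc z'') - bil (pdir (qc z'') N (qc z)) (uc z) (qc z')).
Proof. by move=> sN Wz; rewrite bil_d1 !pdir_semibasic//; ring. Qed.

(** The function N_ij u^i u^j / 2; it is L for N = g. *)
Definition quadratic N z : R := 2^-1 * bil (N (qc z)) (uc z) (uc z).

Lemma smooth_bil_uc N : smooth_mx_on O N ->
  smooth_on W (fun z => bil (N (qc z)) (uc z) (uc z)).
Proof.
move=> sN; have su : smooth_mx_on W (uc : E -> 'cV[R]_n) by exact: smx_uc.
exact: (smxM oW (smxM oW (smx_tr su) (smx_qc sN)) su 0 0).
Qed.

Lemma smooth_quadratic N : smooth_mx_on O N -> smooth_on W (quadratic N).
Proof. by move=> sN; apply: smoothM oW (smooth_cst _ _) (smooth_bil_uc sN). Qed.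

Lemma vact_quadratic N z z' : smooth_mx_on O N -> (N (qc z))^T = N (qc z) -> W z ->
  vact (fun=> z') (quadratic N) z =
  2^-1 * bil (pdir (qc z') N (qc z)) (uc z) (uc z) + bil (N (qc z)) (uc z) (uc z').
Proof.
move=> sN Nsym Wz; rewrite (vactM _ Wz (smooth_cst _ _) (smooth_bil_uc sN)) vact_cst.
rewrite (vact_bil _ oW Wz (smx_qc sN) (@smx_uc _ _ _) (@smx_uc _ _ _)).
rewrite pdir_qc !pdir_uc0 -{2}Nsym bil_tr; lra.
Qed.

Variable g : 'cV[R]_n -> 'M[R]_n.
Hypothesis sg : smooth_mx_on O g.
Hypothesis gsym : forall x, O x -> (g x)^T = g x.
Hypothesis gunit : forall x, O x -> g x \in unitmx.

Lemma bilgC x v w : O x -> bil (g x) v w = bil (g x) w v.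
Proof. by move=> Ox; rewrite -{1}(gsym Ox) bil_tr. Qed.

Lemma bilg_injr x v w : O x -> (forall y, bil (g x) y v = bil (g x) y w) -> v = w.
Proof.
move=> Ox vw; suff : g x *m v = g x *m w by move/(can_inj (mulKmx (gunit Ox))).
apply: bil1_inj => y; rewrite -!bilMr mul1mx; exact: vw.
Qed.

Lemma bilg_injl x v w : O x -> (forall y, bil (g x) v y = bil (g x) w y) -> v = w.
Proof.
by move=> Ox vw; apply: (bilg_injr Ox) => y; rewrite bilgC// [RHS]bilgC.
Qed.

Lemma pdir_gC x v w w' : O x -> bil (pdir v g x) w w' = bil (pdir v g x) w' w.
Proof.
move=> Ox; have E : (pdir v g x)^T = pdir v g x.
  by rewrite -pdir_tr; exact: pdir_eq_on oO Ox gsym.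
by rewrite -{1}E bil_tr.
Qed.

Let L := quadratic g.

(** The image of S is vertical, where dL is given by g(u, .). *)
Lemma dK_quadratic (S : E -> 'M[R]_(n + n)) N z : W z ->
  (forall z', qc (S z *m z') = 0) ->
  (forall z', bil (g (qc z)) (uc z) (uc (S z *m z')) = bil (N (qc z)) (uc z) (qc z')) ->
  dK S L z = semibasic N z.
Proof.
move=> Wz S0 SN; apply: mulmx_inj => z'; apply/matrixP => i j; rewrite !ord1 semibasicE.
rewrite /dK -mulmxA d0_mul vact_quadratic ?S0 ?SN//; last exact: gsym.
by rewrite pdir0v bil0m mulr0 add0r.
Qed.

Lemma theta_semibasic z : W z -> dK (fun=> vertS) L z = semibasic g z.
Proof. by move=> Wz; apply: dK_quadratic => // z'; rewrite vertS_mul ?qc_col ?uc_col. Qed.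

Lemma energy_quadratic z : W z -> vact Liouville L z - L z = L z.
Proof.
move=> Wz; rewrite -[vact _ _ _]/(vact (fun=> Liouville z) L z) vact_quadratic//; last exact: gsym.
by rewrite /Liouville qc_col uc_col pdir0v bil0m /L /quadratic; lra.
Qed.

Lemma d0_energy z : W z -> d0 (fun y => vact Liouville L y - L y) z = d0 L z.
Proof.
move=> Wz; apply/matrixP => i j; rewrite !mxE.
by apply: (pd_eq_on _ oW Wz) => y Wy; exact: energy_quadratic.
Qed.

Section Spray.
Variable G : E -> E.
Hypothesis sG : smooth_mx_on W G.
Hypothesis EL : forall z, W z ->
  iprod (G z) (d1 (dK (fun=> vertS) L) z) = - d0 (fun y => vact Liouville L y - L y) z.

Lemma theta_d1 z : W z -> d1 (dK (fun=> vertS) L) z = d1 (semibasic g) z.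
Proof. by move=> Wz; apply: (d1_eq_on oW Wz) => y Wy; exact: theta_semibasic. Qed.

Lemma ELbil z z' : W z -> bil (d1 (semibasic g) z) (G z) z' = - vact (fun=> z') L z.
Proof.
move=> Wz; rewrite -theta_d1// /bil -[_ *m _ *m _]/(iprod _ _ *m _) EL//.
by rewrite d0_energy// mulNmx mxE d0_mul.
Qed.

(** The vertical part of the Euler-Lagrange equation says that Gamma is a second
order field. *)
Lemma spray_qc z : W z -> qc (G z) = uc z.
Proof.
move=> Wz; apply: (bilg_injr Wz) => y; have := ELbil (col_mx 0 y) Wz.
rewrite bil_d1_semibasic// vact_quadratic//; last exact: gsym.
rewrite qc_col uc_col pdir0v !bil0m !bil0r => H.
by rewrite [RHS]bilgC//; lra.
Qed.

Let b z := uc (G z).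

(** The horizontal part of the Euler-Lagrange equation is the geodesic equation. *)
Lemma spray_uc z w : W z -> bil (g (qc z)) (b z) w =
  2^-1 * bil (pdir w g (qc z)) (uc z) (uc z) - bil (pdir (uc z) g (qc z)) (uc z) w.
Proof.
move=> Wz; have := ELbil (col_mx w 0) Wz.
rewrite bil_d1_semibasic// vact_quadratic//; last exact: gsym.
rewrite qc_col uc_col spray_qc// !bil0r bil0l -/(b z); lra.
Qed.

Lemma conn_mul z v : conn G z *m v = - 2^-1 *: pdir (col_mx 0 v) b z.
Proof.
apply/matrixP => i j; rewrite ord1 !mxE /vact mulr_sumr big_split_ord/=.
rewrite [X in _ = X + _]big1 ?add0r.
  by apply: eq_bigr => k _; rewrite col_mxEd mxE mulrCA mulrC mulrA.
by move=> k _; rewrite col_mxEu mxE mul0r mulr0.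
Qed.

Let smu : smooth_mx_on W (uc : E -> 'cV[R]_n) := @smx_uc _ _ _.
Let smb : smooth_mx_on W b := smx_ucF sG.

Lemma smx_conn : smooth_mx_on W (conn G).
Proof.
apply: (@smx_entries _ _ _ _ W (conn G)
  (fun i j z => - 2^-1 * pd (fun y => b y i 0) (rshift n j) z)).
  by move=> z i j; rewrite mxE.
move=> i j; apply: smoothM => //; first exact: smooth_cst.
by apply: smooth_pd; exact: smb.
Qed.

(** Koszul's formula for the Levi-Civita connection: the fibre derivative of the
geodesic equation, as C is -1/2 times the fibre derivative of b. *)
Lemma koszul z v w : W z -> bil (g (qc z)) (conn G z *m v) w =
  2^-1 * (bil (pdir v g (qc z)) (uc z) w + bil (pdir (uc z) g (qc z)) v w
          - bil (pdir w g (qc z)) (uc z) v).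
Proof.
move=> Wz; rewrite conn_mul bilZl.
have sgw : smooth_mx_on O (pdir w g) by exact: smx_pdir oO (smx_cst _ _) sg.
have sgu := smx_pdir_uc oO sg.
pose A y := bil (pdir w g (qc y)) (uc y) (uc y).
pose B y := bil (pdir (uc y) g (qc y)) (uc y) w.
have sA : smooth_on W A by exact: smooth_bil_uc.
have sB : smooth_on W B by exact: (smxM oW (smxM oW (smx_tr smu) sgu) (smx_cst _ w) 0 0).
have := @vact_eq_on _ _ W (fun y => bil (g (qc y)) (b y) w)
  (fun y => 2^-1 * A y + (-1) * B y) (fun=> col_mx 0 v) z oW Wz.
move=> /(_ _)/wrap[y Wy|]; first by rewrite spray_uc// mulN1r.
rewrite (vact_bil _ oW Wz (smx_qc sg) smb (smx_cst _ _)) pdir_qc qc_col pdir0v bil0m.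
rewrite pdir_cst bil0r (vactD _ Wz); last 2 first.
- exact: smoothM oW (smooth_cst _ _) sA.
- exact: smoothM oW (smooth_cst _ _) sB.
rewrite (vactM _ Wz (smooth_cst _ _) sA) (vactM _ Wz (smooth_cst _ _) sB) !vact_cst.
rewrite /A /B (vact_bil _ oW Wz (smx_qc sgw) smu smu).
rewrite (vact_bil _ oW Wz sgu smu (smx_cst _ _)) (pdir_qc _ (pdir w g)) qc_col pdir0v bil0m.
rewrite (pdir_pdir_uc oO v Wz sg) !pdir_uc0 uc_col pdir_cst bil0r.
rewrite (pdir_gC w v (uc z) Wz); lra.
Qed.

Lemma conn_uc z : W z -> conn G z *m uc z = - b z.
Proof.
move=> Wz; apply: (bilg_injl Wz) => w; rewrite koszul// bilNl spray_uc//; lra.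
Qed.

(** Compatibility with g along Gamma. *)
Lemma conn_metric z v w : W z ->
  bil (g (qc z)) (conn G z *m v) w + bil (g (qc z)) v (conn G z *m w) =
  bil (pdir (uc z) g (qc z)) v w.
Proof.
move=> Wz; rewrite [X in _ + X]bilgC// !koszul//.
rewrite (pdir_gC (uc z) w v Wz) (pdir_gC w (uc z) v Wz) (pdir_gC v (uc z) w Wz); lra.
Qed.

(** Linearity in u and absence of torsion: Gamma^i_jk u^j w^k is symmetric in u
and w. *)
Lemma conn_sym x v w : O x -> conn G (col_mx x v) *m w = conn G (col_mx x w) *m v.
Proof.
move=> Ox; have Wz v' : W (col_mx x v') by rewrite /= qc_col.
apply: (@bilg_injl x) => // y; have := koszul w y (Wz v); have := koszul v y (Wz w).
rewrite !qc_col !uc_col => -> ->.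
rewrite (pdir_gC y w v Ox); lra.
Qed.

(** Horizontal and vertical lifts span Lagrangian subspaces that are paired by g. *)
Lemma omega_conn z z' z'' : W z -> bil (d1 (semibasic g) z) z' z'' =
  bil (g (qc z)) (uc z' + conn G z *m qc z') (qc z'') -
  bil (g (qc z)) (uc z'' + conn G z *m qc z'') (qc z').
Proof.
move=> Wz; rewrite bil_d1_semibasic// !bilDl !koszul//.
rewrite (pdir_gC (uc z) (qc z'') (qc z') Wz); lra.
Qed.

(** Equivalently, L is constant along horizontal fields. *)
Lemma lagrangian_horizontal z w : W z ->
  vact (fun=> col_mx w 0) L z = bil (g (qc z)) (uc z) (conn G z *m w).
Proof.
move=> Wz; rewrite vact_quadratic//; last exact: gsym.
by rewrite qc_col uc_col bil0r addr0 bilgC// koszul//; rewrite (pdir_gC (uc z) w (uc z) Wz); lra.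
Qed.

End Spray.
End Lagrangian.

(** * The tensors J, R, U and the Jacobi endomorphism in one chart *)

(** J with its upper index lowered.  The product has a name so that it can be made
opaque: it must not be unfolded when it is compared with g. *)
Definition lower (R : realType) n (g J : 'cV[R]_n -> 'M[R]_n) x : 'M[R]_n := g x *m J x.

Lemma bil_lower (R : realType) n (g J : 'cV[R]_n -> 'M[R]_n) x v w :
  bil (lower g J x) v w = bil (g x) v (J x *m w).
Proof. exact: bilMr. Qed.

Lemma smx_lower (R : realType) n O (g J : 'cV[R]_n -> 'M[R]_n) : open O ->
  smooth_mx_on O g -> smooth_mx_on O J -> smooth_mx_on O (lower g J).
Proof. by move=> oO sg sJ; exact: smxM. Qed.

Lemma pdir_lower (R : realType) n O (g J : 'cV[R]_n -> 'M[R]_n) v x : open O -> O x ->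
  smooth_mx_on O g -> smooth_mx_on O J ->
  pdir v (lower g J) x = pdir v g x *m J x + g x *m pdir v J x.
Proof. by move=> oO Ox sg sJ; exact: (pdirM v oO Ox sg sJ). Qed.

(** The data of the theorem in one chart.  Here G is the spray with vertical part b
and connection matrix C, fr is the row of d^H f, p that of theta_L, Xi is xi_f,
and M is the lower left block of R. *)
Section Chart.
Local Opaque pd conn semibasic lower.
Context {R : realType} {n : nat}.
Local Notation E := 'cV[R]_(n + n).
Variable O : set 'cV[R]_n.
Hypothesis oO : open O.
Local Notation W := (qc @^-1` O : set E).
Let oW : open W := open_tangent oO.
Implicit Types (v w : 'cV[R]_n) (z : E).

Variable g : 'cV[R]_n -> 'M[R]_n.
Hypothesis sg : smooth_mx_on O g.
Hypothesis gsym : forall x, O x -> (g x)^T = g x.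
Hypothesis gunit : forall x, O x -> g x \in unitmx.
Let L := quadratic g.

Variable G : E -> E.
Hypothesis sG : smooth_mx_on W G.
Hypothesis EL : forall z, W z ->
  iprod (G z) (d1 (dK (fun=> vertS) L) z) = - d0 (fun y => vact Liouville L y - L y) z.
Let b z := uc (G z).
Let C := conn G.
Let smu : smooth_mx_on W (uc : E -> 'cV[R]_n) := @smx_uc _ _ _.
Let smb : smooth_mx_on W b := smx_ucF sG.
Let smC : smooth_mx_on W C := smx_conn oO sG.

Lemma omega_inj z z1 z2 : W z ->
  (forall z', bil (d1 (semibasic g) z) z1 z' = bil (d1 (semibasic g) z) z2 z') -> z1 = z2.
Proof.
move=> Wz H; have Hq : qc z1 = qc z2.
  apply: (bilg_injr gunit Wz) => y; have := H (col_mx 0 y).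
  by rewrite !(omega_conn oO sg gsym gunit sG EL)// qc_col uc_col mulmx0 addr0 !bil0r; lra.
suff Hu : uc z1 = uc z2 by rewrite -[z1]qcuc -[z2]qcuc Hq Hu.
apply: (bilg_injl gsym gunit Wz) => y; have := H (col_mx y 0).
rewrite !(omega_conn oO sg gsym gunit sG EL)// qc_col uc_col Hq !bilDl; lra.
Qed.

Lemma pdir_spray_qc z z' : W z -> qc (pdir z' G z) = uc z'.
Proof.
move=> Wz; rewrite -pdir_qcF -[RHS](pdir_uc0 _ z).
by apply: (pdir_eq_on _ oW Wz) => y Wy; exact: (spray_qc oO sg gsym gunit EL).
Qed.

Lemma pdir_spray_vertical z v : uc (pdir (col_mx 0 v) G z) = - 2%:R *: (C z *m v).
Proof.
by rewrite -pdir_ucF conn_mul scalerA mulrNN mulfV ?scale1r.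
Qed.

(** The vertical part of [Gamma, X^V] is Gamma(X) + 2 C X, and its horizontal part
- X contributes - C X. *)
Lemma nablaE X z : W z -> smooth_mx_on W X ->
  nabla G X z = pdir (G z) X z + C z *m X z.
Proof.
move=> Wz sX; rewrite /nabla /vpart bracketE.
have -> : qc (pdir (G z) (vlift X) z - pdir (vlift X z) G z) = - X z.
  rewrite -scaleN1r qcD qcZ pdir_spray_qc// -pdir_qcF uc_col scaleN1r.
  by under eq_fun do rewrite qc_col; rewrite pdir_cst add0r.
have -> : uc (pdir (G z) (vlift X) z - pdir (vlift X z) G z) =
    pdir (G z) X z + 2%:R *: (C z *m X z).
  rewrite -scaleN1r ucD ucZ pdir_spray_vertical -pdir_ucF.
  by rewrite scaleN1r scaleNr opprK; congr (_ + _); under eq_fun do rewrite uc_col.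
by rewrite mulmxN scaler_nat mulr2n addrA addrK.
Qed.

Variable phi : 'cV[R]_n -> R.
Hypothesis sphi : smooth_on O phi.
Let fp z := phi (qc z).
Let fr z : 'rV[R]_n := d0 phi (qc z).

Lemma vact_pullback z z' : vact (fun=> z') fp z = (fr z *m qc z') 0 0.
Proof. by rewrite -[fp]/(phi \o qc) vact_qc d0_mul. Qed.

Lemma d0_pullback z : d0 fp z = row_mx (fr z) 0.
Proof.
apply: mulmx_inj => z'; apply/matrixP => i j; rewrite !ord1 d0_mul vact_pullback.
by rewrite -[z' in RHS]qcuc mul_row_col mul0mx addr0.
Qed.

Let p z : 'rV[R]_n := (uc z)^T *m g (qc z).

Lemma momentumE z v : (p z *m v) 0 0 = bil (g (qc z)) (uc z) v.
Proof. by []. Qed.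

Lemma d0_lagrangian z : W z -> d0 L z = row_mx (p z *m C z) (p z).
Proof.
move=> Wz; apply: mulmx_inj => z'; apply/matrixP => i j; rewrite !ord1 d0_mul.
rewrite (vact_quadratic oO _ sg (gsym Wz) Wz).
rewrite -[z' in RHS]qcuc mul_row_col -mulmxA entryD !momentumE; congr (_ + _).
have := lagrangian_horizontal oO sg gsym gunit sG EL (qc z') Wz.
rewrite (vact_quadratic oO _ sg (gsym Wz) Wz).
by rewrite qc_col uc_col bil0r addr0.
Qed.

(** The 1-form theta_L along tau is parallel along Gamma. *)
Lemma pdir_momentum z : W z -> pdir (G z) p z = p z *m C z.
Proof.
move=> Wz; apply: mulmx_inj => v; apply/matrixP => i j; rewrite !ord1 -mulmxA momentumE.
rewrite (pdirM _ oW Wz (smx_tr smu) (smx_qc sg)) pdir_tr pdir_uc0 pdir_qc.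
rewrite (spray_qc oO sg gsym gunit EL)// mulmxDl entryD -/(bil _ _ _) -/(bil _ _ _).
have := conn_metric oO sg gsym gunit sG EL (uc z) v Wz.
by rewrite (conn_uc oO sg gsym gunit sG EL)// bilNl /bil => <-; rewrite addrA subrr add0r.
Qed.

Variable Xi : E -> E.
Variable Xf : E -> 'cV[R]_n.
Hypothesis sXf : smooth_mx_on W Xf.
Hypothesis HXi : forall z, W z -> iprod (Xi z) (d1 (dK (fun=> vertS) L) z) = - d0 fp z.
Hypothesis HXf : forall z v, W z -> bil (g (qc z)) (Xf z) v = - (fr z *m v) 0 0.

Lemma hamiltonian_vertical z : W z -> Xi z = col_mx 0 (Xf z).
Proof.
move=> Wz; apply: (omega_inj Wz) => z'.
have := HXi Wz; rewrite (theta_d1 oO sg gsym)// => /(congr1 (fun r => (r *m z') 0 0)).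
rewrite mulNmx [RHS]mxE d0_mul vact_pullback -HXf// => H.
rewrite [LHS]H (omega_conn oO sg gsym gunit sG EL)// qc_col uc_col mulmx0 addr0.
by rewrite bil0r subr0.
Qed.

Variables J Jb : 'cV[R]_n -> 'M[R]_n.
Hypothesis sJ : smooth_mx_on O J.
Hypothesis HJb : forall x v w, O x -> bil (g x) (J x *m v) w = bil (g x) v (Jb x *m w).
Let N := lower g J.
Let sN : smooth_mx_on O N := smx_lower oO sg sJ.

Lemma bilN x v w : O x -> bil (N x) v w = bil (g x) (Jb x *m v) w.
Proof. by move=> Ox; rewrite bil_lower (bilgC gsym _ _ Ox) HJb// (bilgC gsym _ _ Ox). Qed.

Variable Jc : E -> 'M[R]_(n + n).
Hypothesis HJc : forall X, smooth_mx_on O X -> forall z, W z ->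
  Jc z *m clift X z = clift (app J X) z /\ Jc z *m vlift (X \o qc) z = vlift (app J X \o qc) z.

(** The complete lifts of constant fields and the vertical lifts span. *)
Lemma complete_lift_block z : W z ->
  Jc z = block_mx (J (qc z)) 0 (pdir (uc z) J (qc z)) (J (qc z)).
Proof.
move=> Wz.
apply: (@mulmx_inj _ _ _ (Jc z)) => z'.
have E1 : z' = col_mx (qc z') 0 + col_mx 0 (uc z').
  by rewrite add_col_mx addr0 add0r qcuc.
rewrite -[in RHS](qcuc z') [RHS]mul_block_col mul0mx addr0 [in LHS]E1.
rewrite mulmxDr; have [_] := HJc (smx_cst O (uc z')) Wz; rewrite /vlift/= => ->.
have [+ _] := HJc (smx_cst O (qc z')) Wz.
rewrite /clift /tangent_map -!pdir_jac pdir_cst => ->.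
rewrite /app (pdirM _ oO Wz sJ (smx_cst _ _)) pdir_cst mulmx0 addr0.
by rewrite add_col_mx addr0.
Qed.

Lemma thetaJ_semibasic z : W z -> dK (fun y => Jc y *m vertS) L z = semibasic N z.
Proof.
move=> Wz; apply: (dK_quadratic oO sg gsym Wz) => z'; rewrite -mulmxA vertS_mul;
  have [_] := HJc (smx_cst O (qc z')) Wz; rewrite /vlift/= /app => ->.
- by rewrite qc_col.
- by rewrite uc_col bil_lower.
Qed.

Lemma thetaJ_d1 z : W z -> d1 (dK (fun y => Jc y *m vertS) L) z = d1 (semibasic N) z.
Proof. by move=> Wz; apply: (d1_eq_on oW Wz) => y Wy; exact: thetaJ_semibasic. Qed.

Variable U : E -> 'M[R]_n.
Hypothesis HU : forall X Y, smooth_mx_on W X -> smooth_mx_on W Y -> forall z, W z ->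
  bil (g (qc z)) (U z *m X z) (Y z) =
  dHform G (form_comp (DVfun L) (J \o qc)) X Y z.

Lemma form_compE X z : W z -> form_comp (DVfun L) (J \o qc) X z = bil (N (qc z)) (uc z) (X z).
Proof.
move=> Wz; rewrite -[LHS]/(vact (fun=> vlift (fun y => J (qc y) *m X y) z) (quadratic g) z).
by rewrite (vact_quadratic oO _ sg (gsym Wz) Wz) /vlift qc_col uc_col pdir0v bil0m mulr0 add0r bil_lower.
Qed.

(** The connection has no torsion; here this is the symmetry of the second fibre
derivatives of Gamma. *)
Lemma DH_cst_sym v w z : W z -> DH G (fun=> v) (fun=> w) z = DH G (fun=> w) (fun=> v) z.
Proof.
move=> Wz; have DHE v' w' : DH G (fun=> v') (fun=> w') z = pdir (col_mx 0 w') C z *m v'.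
  rewrite /DH /vpart bracketE.
  have -> : pdir (hlift G (fun=> v') z) (vlift (fun=> w')) z = 0 by exact: pdir_cst.
  set h := pdir _ (hlift G _) z.
  have hq : (fun y => qc (hlift G (fun=> v') y)) = (fun=> v').
    by apply/funext => y; exact: qc_col.
  have hu : (fun y => uc (hlift G (fun=> v') y)) = (fun y => - (C y *m v')).
    by apply/funext => y; exact: uc_col.
  have -> : qc (0 - h) = 0.
    by rewrite sub0r -scaleN1r qcZ /h -pdir_qcF hq pdir_cst scaler0.
  have -> : uc (0 - h) = pdir (col_mx 0 w') C z *m v'.
    rewrite sub0r -scaleN1r ucZ /h -pdir_ucF hu.
    rewrite (pdirN _ Wz (smxM oW smC (smx_cst _ _))) scaleN1r opprK.
    by rewrite (pdirM _ oW Wz smC (smx_cst _ _)) pdir_cst mulmx0 addr0.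
  by rewrite mulmx0 addr0.
have CE v' w' : pdir (col_mx 0 w') C z *m v' =
    - 2^-1 *: pdir (col_mx 0 w') (pdir (col_mx 0 v') b) z.
  have sbv : smooth_mx_on W (pdir (col_mx 0 v') b).
    exact: smx_pdir oW (smx_cst _ _) smb.
  rewrite -(pdirZ _ _ Wz sbv).
  under [in RHS]eq_fun do rewrite -conn_mul.
  by rewrite (pdirM _ oW Wz smC (smx_cst _ _)) pdir_cst mulmx0 addr0.
by rewrite !DHE !CE (pdir_pdir_sym _ _ oW Wz smb).
Qed.

(** The terms with D^H_X Y and D^H_Y X cancel by [DH_cst_sym]. *)
Lemma U_bil z v w : W z -> bil (g (qc z)) (U z *m v) w =
  bil (pdir v N (qc z)) (uc z) w - bil (N (qc z)) (C z *m v) w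
  - (bil (pdir w N (qc z)) (uc z) v - bil (N (qc z)) (C z *m w) v).
Proof.
move=> Wz; rewrite (HU (smx_cst _ v) (smx_cst _ w))//.
have vE v' w' : vact (hlift G (fun=> v')) (form_comp (DVfun L) (J \o qc) (fun=> w')) z =
    bil (pdir v' N (qc z)) (uc z) w' - bil (N (qc z)) (C z *m v') w'.
  rewrite (@vact_eq_on _ _ W _ (fun y => bil (N (qc y)) (uc y) w') _ z oW Wz) => [|y Wy]; last first.
    exact: form_compE.
  rewrite (vact_at (hlift G (fun=> v'))).
  rewrite (vact_bil _ oW Wz (smx_qc sN) smu (smx_cst _ w')) pdir_qc pdir_uc0 pdir_cst bil0r.
  by rewrite /hlift qc_col uc_col bilNl addr0.
have dE v' w' : DHform G (fun=> v') (form_comp (DVfun L) (J \o qc)) (fun=> w') z =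
    bil (pdir v' N (qc z)) (uc z) w' - bil (N (qc z)) (C z *m v') w' -
    bil (N (qc z)) (uc z) (DH G (fun=> v') (fun=> w') z).
  by rewrite -vE; congr (_ - _); exact: form_compE.
rewrite /dHform !dE (DH_cst_sym v w Wz).
by rewrite opprB addrA subrK.
Qed.

Variable Rt : E -> 'M[R]_(n + n).
Hypothesis sRt : smooth_mx_on W Rt.
Hypothesis HR : forall xi, smooth_mx_on W xi -> forall z, W z ->
  iprod (Rt z *m xi z) (d1 (dK (fun=> vertS) L) z) =
  iprod (xi z) (d1 (dK (fun y => Jc y *m vertS) L) z).

Lemma R_bil z z' z'' : W z ->
  bil (d1 (semibasic g) z) (Rt z *m z') z'' = bil (d1 (semibasic N) z) z' z''.
Proof.
move=> Wz; have := HR (smx_cst _ z') Wz.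
rewrite (theta_d1 oO sg gsym Wz) (thetaJ_d1 Wz).
by move=> /(congr1 (fun r : 'rV_(n + n) => (r *m z'') 0 0)).
Qed.

Let M z := U z + Jb (qc z) *m C z - C z *m J (qc z).

(** Equivalently, R(X^H) = (JX)^H + (UX)^V and R(X^V) = (Jbar X)^V. *)
Lemma R_block z : W z -> Rt z = block_mx (J (qc z)) 0 (M z) (Jb (qc z)).
Proof.
move=> Wz; apply: (@mulmx_inj _ _ _ (Rt z)) => z'; apply: (omega_inj Wz) => z''.
apply: (etrans (R_bil _ _ Wz)).
apply: (etrans _ (esym (omega_conn oO sg gsym gunit sG EL _ _ Wz))).
rewrite (bil_d1_semibasic oO _ _ sN Wz).
rewrite -[z' in RHS]qcuc mul_block_col mul0mx addr0 qc_col uc_col.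
rewrite /M !mulmxDl mulNmx -!mulmxA !bilE (U_bil _ _ Wz).
rewrite -!(bilN _ _ Wz) !bil_lower -/C; ring.
Qed.

Let Bq z := dlsubmx (jac G z).

Lemma spray_jac z : W z -> jac G z = block_mx 0 1%:M (Bq z) (- 2%:R *: C z).
Proof.
move=> Wz; have H v w : col_mx (ulsubmx (jac G z) *m v + ursubmx (jac G z) *m w)
    (dlsubmx (jac G z) *m v + drsubmx (jac G z) *m w) = pdir (col_mx v w) G z.
  by rewrite pdir_jac -mul_block_col submxK.
rewrite -[LHS]submxK; congr block_mx.
- apply: mulmx_inj => v; have := pdir_spray_qc (col_mx v 0) Wz.
  by rewrite -H qc_col uc_col mulmx0 addr0 mul0mx.
- apply: mulmx_inj => v; have := pdir_spray_qc (col_mx 0 v) Wz.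
  by rewrite -H qc_col uc_col mulmx0 add0r mul1mx.
- apply: mulmx_inj => v; have := pdir_spray_vertical z v.
  by rewrite -H uc_col mulmx0 add0r -scalemxAl.
Qed.

Let dJ z := pdir (uc z) J (qc z).
Let dJb z := pdir (uc z) Jb (qc z).

(** The matrix of L_Gamma R. *)
Definition lieR z := pdir (G z) Rt z - jac G z *m Rt z + Rt z *m jac G z.

Lemma lieR_lie11 xi z : smooth_mx_on W xi -> W z -> lie11 G Rt xi z = lieR z *m xi z.
Proof. by move=> sxi Wz; exact: (lie11E oW G Wz sRt sxi). Qed.

Lemma lieR_block z : W z -> lieR z =
  block_mx (dJ z - M z) (J (qc z) - Jb (qc z))
    (pdir (G z) M z - (Bq z *m J (qc z) - 2%:R *: (C z *m M z)) + Jb (qc z) *m Bq z)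
    (dJb z + 2%:R *: (C z *m Jb (qc z)) + M z - 2%:R *: (Jb (qc z) *m C z)).
Proof.
move=> Wz; rewrite /lieR (pdir_eq_on _ oW Wz R_block) pdir_block.
rewrite !pdir_qc pdir_cst (spray_qc oO sg gsym gunit EL Wz) -/(dJ z) -/(dJb z).
rewrite (R_block Wz) (spray_jac Wz) !mulmx_block opp_block_mx !add_block_mx.
rewrite !(mul0mx, mul1mx, mulmx0, mulmx1, add0r, addr0, oppr0).
rewrite -!scalemxAl -!scalemxAr.
by congr block_mx; rewrite ?sub0r ?addNr; mx_ring.
Qed.

Lemma hamiltonian_block z : W z ->
  G z *m d0 fp z - Xi z *m d0 (fun y => vact Liouville L y - L y) z =
  block_mx (uc z *m fr z) 0 (b z *m fr z - Xf z *m (p z *m C z)) (- (Xf z *m p z)).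
Proof.
move=> Wz; rewrite (d0_energy oO sg gsym Wz) d0_pullback d0_lagrangian//.
rewrite hamiltonian_vertical// -[G z]qcuc (spray_qc oO sg gsym gunit EL Wz) -/(b z).
rewrite !mul_col_row opp_block_mx add_block_mx.
by rewrite !(mul0mx, mulmx0, add0r, addr0, oppr0).
Qed.

Variable Phi : E -> 'M[R]_n.
Hypothesis HPhi : forall X, smooth_mx_on W X -> forall z, W z ->
  bracket G (hlift G X) z = hlift G (nabla G X) z + vlift (fun y => Phi y *m X y) z.

(** The bracket that defines Phi is tensorial apart from the term in nabla X, so the
constant X determine Phi. *)
Lemma jacobi_curvature z : W z -> Phi z = - pdir (G z) C z - Bq z - C z *m C z.
Proof.
move=> Wz; apply: mulmx_inj => v.
have hu : (fun y => uc (hlift G (fun=> v) y)) = (fun y => - (C y *m v)).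
  by apply/funext => y; exact: uc_col.
have H0 : pdir (hlift G (fun=> v) z) G z = pdir (col_mx v 0) G z + pdir (col_mx 0 (- (C z *m v))) G z.
  by rewrite -pdir_addv add_col_mx addr0 add0r.
have := HPhi (smx_cst _ v) Wz => /(congr1 uc).
rewrite [in RHS]ucD [in RHS]/hlift [in RHS]/vlift !uc_col -/C (nablaE Wz (smx_cst _ v)).
rewrite bracketE H0 pdir_cst add0r -scaleN1r ucD ucZ ucD pdir_spray_vertical -pdir_ucF hu.
rewrite (pdirN _ Wz (smxM oW smC (smx_cst _ _))).
rewrite (pdirM _ oW Wz smC (smx_cst _ _)) pdir_cst mulmx0 addr0.
rewrite [X in uc X]pdir_jac (spray_jac Wz) mul_block_col uc_col mulmx0 addr0.
rewrite mulmxN => e; rewrite !mulmxBl !mulNmx -mulmxA.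
apply/matrixP => i j; move/matrixP/(_ i j): e.
rewrite !(entryD, entryN, entryZ); lra.
Qed.

Let sfr : smooth_mx_on W fr := smx_qc (smx_d0 sphi).
Let sp : smooth_mx_on W p := smxM oW (smx_tr smu) (smx_qc sg).
Let sJq : smooth_mx_on W (fun z => J (qc z)) := smx_qc sJ.
Let dfr z := pdir (uc z) (d0 phi) (qc z).
Let dXf z := pdir (G z) Xf z.
Let Energy z := vact Liouville L z - L z.

Section Forward.
Hypothesis HLR : forall z, W z -> lieR z = G z *m d0 fp z - Xi z *m d0 Energy z.

Let blocks z (Wz : W z) := eq_block_mx (etrans (esym (lieR_block Wz))
   (etrans (HLR Wz) (hamiltonian_block Wz))).

Lemma J_selfadjoint x : O x -> J x = Jb x.
Proof.
move=> Ox; have Wz : W (col_mx x 0) by rewrite /= qc_col.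
by have [_ /eqP + _ _] := blocks Wz; rewrite subr_eq0 qc_col => /eqP.
Qed.

(** The upper left block is nabla J - U, the lower right block is nabla J + U. *)
Lemma nabla_J z : W z ->
  dJ z + C z *m J (qc z) - J (qc z) *m C z = 2^-1 *: (uc z *m fr z - Xf z *m p z).
Proof.
move=> Wz; have [e1 _ _] := blocks Wz.
have -> : dJb z = dJ z by apply: (pdir_eq_on _ oO Wz) => x /J_selfadjoint.
rewrite -(J_selfadjoint Wz) => e4; apply/matrixP => i j.
move/matrixP/(_ i j): e1; move/matrixP/(_ i j): e4.
rewrite !(entryD, entryN, entryZ); lra.
Qed.

Lemma R_lower_left z : W z -> M z = dJ z - uc z *m fr z.
Proof. by move=> Wz; have [<- _ _ _] := blocks Wz; rewrite opprB addrC subrK. Qed.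

Lemma U_formula z : W z -> U z = - 2^-1 *: (uc z *m fr z + Xf z *m p z).
Proof.
move=> Wz; have := R_lower_left Wz; have := nabla_J Wz.
rewrite /M -(J_selfadjoint Wz) => e1 e2; apply/matrixP => i j.
move/matrixP/(_ i j): e1; move/matrixP/(_ i j): e2.
rewrite !(entryD, entryN, entryZ); lra.
Qed.

Lemma R_formula z : W z -> Rt z = Jc z - Liouville z *m d0 fp z.
Proof.
move=> Wz; rewrite R_block// complete_lift_block// R_lower_left// -(J_selfadjoint Wz).
rewrite /Liouville d0_pullback mul_col_row !mul0mx mulmx0 opp_block_mx add_block_mx.
by rewrite !oppr0 !addr0.
Qed.

(** The lower left block amounts to Phi J - J Phi + nabla U = 0, in which T and
theta_L are parallel along Gamma; the right hand side is written with
nabla d^H f = dfr - fr C and nabla X_f = dXf + C X_f. *)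
Lemma jacobi_commutator z : W z ->
  Phi z *m J (qc z) - J (qc z) *m Phi z =
  2^-1 *: (uc z *m (dfr z - fr z *m C z) + (dXf z + C z *m Xf z) *m p z).
Proof.
move=> Wz.
have eJ : dJ z = 2^-1 *: (uc z *m fr z) - 2^-1 *: (Xf z *m p z) - C z *m J (qc z) + J (qc z) *m C z.
  apply/matrixP => i j; move/matrixP/(_ i j): (nabla_J Wz).
  by rewrite !(entryD, entryN, entryZ); lra.
pose M' y := - 2^-1 *: (uc y *m fr y + Xf y *m p y) + (J (qc y) *m C y - C y *m J (qc y)).
have MM' y : W y -> M y = M' y.
  move=> Wy; rewrite /M U_formula// /M' -(J_selfadjoint Wy).
  by rewrite addrA.
have sufr := smxM oW smu sfr; have sXp := smxM oW sXf sp.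
have sJC := smxM oW sJq smC; have sCJ := smxM oW smC sJq.
have eM : pdir (G z) M z = - 2^-1 *: (b z *m fr z + uc z *m dfr z +
    (dXf z *m p z + Xf z *m (p z *m C z))) +
    (dJ z *m C z + J (qc z) *m pdir (G z) C z - (pdir (G z) C z *m J (qc z) + C z *m dJ z)).
  have Gq : qc (G z) = uc z by exact: (spray_qc oO sg gsym gunit EL Wz).
  rewrite (pdir_eq_on _ oW Wz MM') (pdirD _ Wz (smxZ _ oW (smxD oW sufr sXp)) (smxB oW sJC sCJ)).
  rewrite (pdirZ _ _ Wz (smxD oW sufr sXp)) (pdirD _ Wz sufr sXp) (pdirB _ oW Wz sJC sCJ).
  rewrite (pdirM _ oW Wz smu sfr) (pdirM _ oW Wz sXf sp).
  rewrite (pdirM _ oW Wz sJq smC) (pdirM _ oW Wz smC sJq).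
  by rewrite pdir_uc0 (pdir_qc _ (d0 phi)) !(pdir_qc _ J) pdir_momentum// Gq.
have [_ _ e3 _] := blocks Wz; move: e3.
have Cu : C z *m uc z = - b z by exact: (conn_uc oO sg gsym gunit sG EL Wz).
rewrite eM (MM' _ Wz) /M' jacobi_curvature// eJ -(J_selfadjoint Wz).
rewrite !(mulmxDl, mulmxDr, mulmxBl, mulmxBr, mulNmx, mulmxN, scalerDr, scalerN, scalerBr, opprD).
rewrite -!scalemxAl -!scalemxAr !(mulmxA, Cu, mulNmx).
move=> e3; apply/matrixP => i j; move/matrixP/(_ i j): e3.
rewrite !(entryD, entryN, entryZ); lra.
Qed.

End Forward.

(** The contraction of omega with R is omega_J, and both forms obey Cartan's
formula, while i_Gamma omega = - dL is closed. *)
Lemma lieR_omega z : W z ->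
  (lieR z)^T *m d1 (semibasic g) z = d1 (fun y => iprod (G y) (d1 (semibasic N) y)) z.
Proof.
move=> Wz.
have sbg := smx_semibasic oO sg; have sbN := smx_semibasic oO sN.
have RN y : W y -> (Rt y)^T *m d1 (semibasic g) y = d1 (semibasic N) y.
  by move=> Wy; apply: bilP => v w; rewrite bilMl R_bil.
have dRN := pdirM (G z) oW Wz (smx_tr sRt) (smx_d1 oW sbg).
rewrite (pdir_eq_on _ oW Wz RN) pdir_tr in dRN.
rewrite (lie_d1 oW Wz sG sbN) dRN -(RN z Wz).
have : d1 (fun y => iprod (G y) (d1 (semibasic g) y)) z = 0.
  have E y : W y -> iprod (G y) (d1 (semibasic g) y) = - d0 L y.
    by move=> Wy; rewrite -(theta_d1 oO sg gsym Wy) EL// (d0_energy oO sg gsym Wy).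
  have sL : smooth_on W L by exact: (smooth_quadratic oO sg).
  by rewrite (d1_eq_on oW Wz E) (d1N Wz (smx_d0 sL)) (d1_d0 oW Wz sL) oppr0.
rewrite (lie_d1 oW Wz sG sbg) => e.
have {}e : pdir (G z) (d1 (semibasic g)) z =
    - ((jac G z)^T *m d1 (semibasic g) z) - d1 (semibasic g) z *m jac G z.
  apply/matrixP => i j; move/matrixP/(_ i j): e.
  by rewrite !(entryD, entryN, entry0); lra.
rewrite e /lieR; move: (pdir (G z) Rt z) (jac G z) (Rt z) (d1 (semibasic g) z) => A j r w.
rewrite !linearD/= linearN/= !trmx_mul !(mulmxDl, mulmxDr, mulNmx, mulmxN) !mulmxA.
mx_ring.
Qed.

Section Converse.
Hypothesis HJJ : forall x, O x -> J x = Jb x.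
Hypothesis HNJ : forall z, W z ->
  dJ z + C z *m J (qc z) - J (qc z) *m C z = 2^-1 *: (uc z *m fr z - Xf z *m p z).

Lemma lower_sym x : O x -> (N x)^T = N x.
Proof.
move=> Ox; apply: bilP => v w; rewrite bil_tr bilN// -HJJ// /N bil_lower.
exact: (bilgC gsym).
Qed.

(** The covariant derivative of gJ along u, obtained from that of J and the
compatibility of the connection with g. *)
Lemma pdir_lower_conn z v w : W z -> bil (pdir (uc z) N (qc z)) v w =
  bil (N (qc z)) (C z *m v) w + bil (N (qc z)) v (C z *m w) +
  2^-1 * (bil (g (qc z)) v (uc z) * (fr z *m w) 0 0 +
          (fr z *m v) 0 0 * bil (g (qc z)) (uc z) w).
Proof.
move=> Wz; rewrite (pdir_lower _ oO Wz sg sJ) bilDm !bilMr -/(dJ z).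
rewrite -(conn_metric oO sg gsym gunit sG EL _ _ Wz) -/C.
have -> : dJ z *m w = 2^-1 *: ((fr z *m w) 0 0 *: uc z - (p z *m w) 0 0 *: Xf z)
    - C z *m (J (qc z) *m w) + J (qc z) *m (C z *m w).
  have := congr1 (fun A => A *m w) (HNJ Wz); rewrite -scalemxAl !mulmxDl !mulNmx.
  rewrite !mul_col_row1 -!mulmxA => e; apply/matrixP => i j; move/matrixP/(_ i j): e.
  by rewrite !(entryD, entryN, entryZ); lra.
rewrite !bilE (bilgC gsym _ (Xf z) Wz) (HXf _ Wz) momentumE; ring.
Qed.

(** The derivative of gJ is needed along u and, for the quadratic form, along the
arbitrary direction qc z'; the latter is supplied by the formula for nabla J
at the point (q, qc z') of the same fibre. *)
Lemma contraction_omegaJ z : W z ->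
  iprod (G z) (d1 (semibasic N) z) = L z *: d0 fp z - d0 (quadratic N) z.
Proof.
move=> Wz; apply: (@mulmx_inj _ _ _ (iprod _ _)) => z'; apply/matrixP => i j; rewrite !ord1.
rewrite mulmxBl -scalemxAl entryD entryN entryZ !d0_mul vact_pullback.
rewrite (vact_quadratic oO _ sN (lower_sym Wz) Wz).
rewrite -[LHS]/(bil (d1 (semibasic N) z) (G z) z') (bil_d1_semibasic oO _ _ sN Wz).
rewrite (spray_qc oO sg gsym gunit EL Wz) -/(b z) (pdir_lower_conn _ _ Wz).
have Cu : C z *m uc z = - b z by exact: (conn_uc oO sg gsym gunit sG EL Wz).
have Wv : W (col_mx (qc z) (qc z')) by rewrite /= qc_col.
have := pdir_lower_conn (uc z) (uc z) Wv; rewrite !qc_col !uc_col /fr qc_col -/(fr z) => ->.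
have -> : C (col_mx (qc z) (qc z')) *m uc z = C z *m qc z'.
  by rewrite /C (conn_sym oO sg gsym gunit sG EL _ _ Wz) qcuc.
rewrite Cu bilNl -[bil (N (qc z)) (uc z') _]bil_tr lower_sym//.
rewrite -[bil (N (qc z)) (C z *m _) _]bil_tr lower_sym// (bilgC gsym (qc z') _ Wz).
by rewrite /L /quadratic; field.
Qed.

(** By [contraction_omegaJ] both sides have the same contraction dL /\ df with
omega. *)
Lemma lieR_hamiltonian z : W z -> lieR z = G z *m d0 fp z - Xi z *m d0 Energy z.
Proof.
move=> Wz; have sL : smooth_on W L by exact: (smooth_quadratic oO sg).
have sfp : smooth_on W fp by exact: smooth_qc.
have sQ : smooth_on W (quadratic N) by exact: (smooth_quadratic oO sN).
have sLf : smooth_mx_on W (fun y => L y *: d0 fp y).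
  apply: (@smx_entries _ _ _ _ W _ (fun i j y => L y * pd fp j y)).
    by move=> y i j; rewrite !mxE.
  by move=> i j; apply: smoothM => //; exact: smooth_pd.
apply: (@mulmx_inj _ _ _ (lieR z)) => z'; apply: (omega_inj Wz) => z''.
rewrite -!bilMl; congr bil; rewrite lieR_omega//.
rewrite (d1_eq_on oW Wz contraction_omegaJ) (d1D Wz sLf (smxN oW (smx_d0 sQ))).
rewrite (d1N Wz (smx_d0 sQ)) (d1_d0 oW Wz sQ) oppr0 addr0 (d1_scale_d0 oW Wz sL sfp).
have eG : (G z)^T *m d1 (semibasic g) z = - d0 L z.
  by rewrite -(theta_d1 oO sg gsym Wz) -[LHS]/(iprod _ _) EL// (d0_energy oO sg gsym Wz).
have eX : (Xi z)^T *m d1 (semibasic g) z = - d0 fp z.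
  by rewrite -(theta_d1 oO sg gsym Wz) -[LHS]/(iprod _ _) HXi.
rewrite (d0_energy oO sg gsym Wz) linearB/= !trmx_mul mulmxBl -!mulmxA eG eX.
by rewrite !mulmxN opprK addrC.
Qed.

End Converse.

Lemma dHfun_pullback X z : dHfun G fp X z = (fr z *m X z) 0 0.
Proof. by rewrite /dHfun vact_at vact_pullback /hlift qc_col. Qed.

Lemma theta_tauE X z : W z -> DVfun L X z = (p z *m X z) 0 0.
Proof.
move=> Wz; rewrite /DVfun vact_at (vact_quadratic oO _ sg (gsym Wz) Wz).
by rewrite /vlift qc_col uc_col pdir0v bil0m mulr0 add0r.
Qed.

Lemma nabla_dH X z : W z -> smooth_mx_on W X ->
  nabla_form G (dHfun G fp) X z = ((dfr z - fr z *m C z) *m X z) 0 0.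
Proof.
move=> Wz sX; rewrite /nabla_form dHfun_pullback (nablaE Wz sX).
have -> : dHfun G fp X = fun y => (fr y *m X y) 0 0.
  by apply/funext => y; exact: dHfun_pullback.
have -> : vact G (fun y => (fr y *m X y) 0 0) z = pdir (G z) (fun y => fr y *m X y) z 0 0.
  by rewrite mxE.
rewrite (pdirM _ oW Wz sfr sX) (pdir_qc _ (d0 phi)) (spray_qc oO sg gsym gunit EL Wz).
by rewrite -/(dfr z) mulmxBl mulmxDr mulmxA !(entryD, entryN); ring.
Qed.

Lemma nabla11_J X z : W z -> smooth_mx_on W X ->
  nabla11 G (J \o qc) X z = (dJ z + C z *m J (qc z) - J (qc z) *m C z) *m X z.
Proof.
move=> Wz sX; rewrite /nabla11 (nablaE Wz sX) (nablaE Wz (smxM oW sJq sX)).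
rewrite (pdirM _ oW Wz sJq sX) (pdir_qc _ J) (spray_qc oO sg gsym gunit EL Wz) -/(dJ z) /=.
by rewrite mulmxBl !mulmxDl mulmxDr -!mulmxA; mx_ring.
Qed.

Let LieR_eq := forall xi, smooth_mx_on W xi -> forall z, W z ->
  lie11 G Rt xi z = (G z *m d0 fp z - Xi z *m d0 Energy z) *m xi z.

Let nabla_eq := forall X, smooth_mx_on W X -> forall z, W z ->
  nabla11 G (J \o qc) X z =
  2^-1 *: (tens canT (dHfun G fp) X z - tens Xf (DVfun L) X z).

Lemma LieR_eqP : LieR_eq <-> forall z, W z -> lieR z = G z *m d0 fp z - Xi z *m d0 Energy z.
Proof.
split=> H.
- move=> z Wz; apply: (@mulmx_inj _ _ _ (lieR z)) => v.
  by rewrite -(lieR_lie11 (smx_cst _ v) Wz) H//; exact: smx_cst.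
- by move=> xi sxi z Wz; rewrite lieR_lie11// H.
Qed.

Lemma tens_canT_dH X z : tens canT (dHfun G fp) X z = uc z *m fr z *m X z.
Proof. by rewrite /tens dHfun_pullback mul_col_row1. Qed.

Lemma tens_Xf_theta X z : W z -> tens Xf (DVfun L) X z = Xf z *m p z *m X z.
Proof. by move=> Wz; rewrite /tens theta_tauE// mul_col_row1. Qed.

Lemma nabla_eqP : nabla_eq <-> forall z, W z ->
  dJ z + C z *m J (qc z) - J (qc z) *m C z = 2^-1 *: (uc z *m fr z - Xf z *m p z).
Proof.
split=> H.
- move=> z Wz; apply: (@mulmx_inj _ _ _ (dJ z + _ - _)) => v.
  rewrite -(nabla11_J Wz (smx_cst _ v)) (H _ (smx_cst _ v) _ Wz).
  by rewrite tens_canT_dH tens_Xf_theta// -scalemxAl mulmxBl.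
- move=> X sX z Wz; rewrite nabla11_J// H// tens_canT_dH tens_Xf_theta//.
  by rewrite -scalemxAl mulmxBl.
Qed.

Lemma chart_equivalence : LieR_eq <-> (forall x, O x -> J x = Jb x) /\ nabla_eq.
Proof.
split=> [/LieR_eqP H | [HJJ /nabla_eqP HN]].
- by split; [exact: (J_selfadjoint H)|apply/nabla_eqP; exact: nabla_J].
- by apply/LieR_eqP; exact: lieR_hamiltonian.
Qed.

Lemma chart_consequences : LieR_eq ->
  [/\ forall X, smooth_mx_on W X -> forall z, W z ->
        U z *m X z = - 2^-1 *: (tens canT (dHfun G fp) X z + tens Xf (DVfun L) X z),
      forall X, smooth_mx_on W X -> forall z, W z ->
        (Phi z *m J (qc z) - J (qc z) *m Phi z) *m X z =
        2^-1 *: (tens canT (nabla_form G (dHfun G fp)) X z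
                 + tens (nabla G Xf) (DVfun L) X z)
    & forall z, W z -> Rt z = Jc z - Liouville z *m d0 fp z].
Proof.
move=> /LieR_eqP H; split.
- move=> X _ z Wz; rewrite (U_formula H)// tens_canT_dH tens_Xf_theta//.
  by rewrite -scalemxAl mulmxDl.
- move=> X sX z Wz; rewrite (jacobi_commutator H)// /tens nabla_dH// theta_tauE//.
  by rewrite (nablaE Wz sXf) -scalemxAl mulmxDl !mul_col_row1.
- exact: R_formula.
Qed.

End Chart.

(** * The theorem *)

Unset Implicit Arguments.

Theorem theorem1 (R : realType) (n : nat) (Q : manifold R n)
    (g : tensor02 (onQ Q)) (J Jbar : tensor11 (onQ Q)) (f : smooth_fun Q)
    (Gam xi_f : vector_field (onTQ Q)) (Jc Rt : tensor11 (onTQ Q))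
    (X_f : vector_field (alongtau Q)) (U Phi : tensor11 (alongtau Q))
    (g_sym : symmetric02 g) (g_nonsing : nonsingular g)
    (HJbar : g_transpose g J Jbar)
    (HGam : euler_lagrange g Gam)
    (Hxi_f : hamiltonian g f xi_f)
    (HJc : is_complete_lift J Jc)
    (HRt : is_R g Jc Rt)
    (HX_f : is_Xf g Gam f X_f)
    (HU : is_U g Gam J U)
    (HPhi : is_jacobi Gam Phi) :
  let LieR_eq :=
    forall (a : idx (onTQ Q)) (xi : 'cV[R]_(n + n) -> 'cV[R]_(n + n)),
      smooth_mx_on (chart a) xi -> forall z, chart a z ->
      lie11 (Gam a) (Rt a) xi z =
      (Gam a z *m d0 (pullback f a) z - xi_f a z *m d0 (energy g a) z) *m xi z in
  (LieR_eq <->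
    (forall (a : idx (onQ Q)) x, chart a x -> J a x = Jbar a x) /\
    (forall (a : idx (alongtau Q)) (X : 'cV[R]_(n + n) -> 'cV[R]_n),
      smooth_mx_on (chart a) X -> forall z, chart a z ->
      nabla11 (Gam a) (J a \o qc) X z =
      2^-1 *: (tens canT (dHfun (Gam a) (pullback f a)) X z
               - tens (X_f a) (theta_tau g a) X z))) /\
  (LieR_eq ->
    [/\ forall (a : idx (alongtau Q)) (X : 'cV[R]_(n + n) -> 'cV[R]_n),
          smooth_mx_on (chart a) X -> forall z, chart a z ->
          U a z *m X z =
          - 2^-1 *: (tens canT (dHfun (Gam a) (pullback f a)) X z
                     + tens (X_f a) (theta_tau g a) X z),
        forall (a : idx (alongtau Q)) (X : 'cV[R]_(n + n) -> 'cV[R]_n),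
          smooth_mx_on (chart a) X -> forall z, chart a z ->
          (Phi a z *m J a (qc z) - J a (qc z) *m Phi a z) *m X z =
          2^-1 *: (tens canT (nabla_form (Gam a) (dHfun (Gam a) (pullback f a))) X z
                   + tens (nabla (Gam a) (X_f a)) (theta_tau g a) X z)
      & forall (a : idx (onTQ Q)) z, chart a z ->
          Rt a z = Jc a z - Liouville z *m d0 (pullback f a) z]).
Proof.
move=> LieR_eq; have HXf a z v : (qc @^-1` img a) z ->
    bil (g a (qc z)) (X_f a z) v = - (d0 (f \o param a) (qc z) *m v) 0 0.
  move=> Wz; have := HX_f a (fun=> v) (smx_cst _ v) z Wz.
  by rewrite (dHfun_pullback (Gam a) (f \o param a)).
have HJb a x (v w : 'cV[R]_n) : img a x ->
    bil (g a x) (J a x *m v) w = bil (g a x) v (Jbar a x *m w).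
  by move=> Ox; exact: HJbar.
have equiv a := chart_equivalence (@img_open R n Q a) (t02_smooth g a) (g_sym a) (g_nonsing a)
  (vf_smooth Gam a) (HGam a) (sf_smooth f a) (Hxi_f a) (HXf a) (t11_smooth J a)
  (HJb a) (HJc a) (HU a) (t11_smooth Rt a) (HRt a).
have conseq a := chart_consequences (@img_open R n Q a) (t02_smooth g a) (g_sym a) (g_nonsing a)
  (vf_smooth Gam a) (HGam a) (sf_smooth f a) (vf_smooth X_f a) (Hxi_f a) (HXf a)
  (t11_smooth J a) (HJb a) (HJc a) (HU a) (t11_smooth Rt a) (HRt a) (HPhi a).
split; first split.
- by move=> H; split=> a; have [] := (equiv a).1 (H a).
- by case=> HJJ HN a; apply: (equiv a).2; split; [exact: HJJ|exact: HN].
- by move=> H; split=> a; have [] := conseq a (H a).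
Qed.
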